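(* Let $K$ be a field and $S=K[x_1,\ldots,x_n]$. If $I\subset S$ is a monomial ideal of forest type, then $S/I$ is sequentially Cohen--Macaulay.
   Context: For a monomial ideal $I$, $G(I)$ denotes its unique minimal set of monomial generators. Let $A$ be a nonempty finite set of monomials. An element $u\in A$ is called a leaf of $A$ if $u$ is the only element of $A$, or there exists $v\in A$, $v\ne u$, such that $\gcd(u,w)\mid\gcd(u,v)$ for all $w\in A$ with $w\neq u$. A monomial ideal $I$ is of forest type if every nonempty subset of $G(I)$ has a leaf. $S/I$ is sequentially Cohen--Macaulay if it has a Cohen--Macaulay filtration, i.e. a finite chain of ideals $I=I_0\subset I_1\subset\cdots\subset I_r=S$ such that each quotient $I_j/I_{j-1}$ is Cohen--Macaulay and $\dim(I_1/I_0)<\dim(I_2/I_1)<\cdots<\dim(I_r/I_{r-1})$. *)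

(* Defs.v *)
From HB Require Import structures.
From mathcomp Require Import all_boot all_order all_algebra finmap.
From mathcomp Require Import boolp classical_sets.
From mathcomp Require Import mpoly.

Set Implicit Arguments.
Unset Strict Implicit.
Unset Printing Implicit Defensive.

Import GRing.Theory.

Local Open Scope ring_scope.
Local Open Scope classical_set_scope.

(** Modules are represented as subquotients.  In a commutative ring [F], let
    [A] be a subring and [J `<=` L] two [A]-submodules of [F]; the pair [L], [J]
    stands for the [A]-module [L / J].  With [A = setT] this covers quotients
    of ideals of [F]; with [F] a field of fractions it covers their
    localizations. *)
Section Subquotients.
Variable F : comNzRingType.
Implicit Types (A P L J m : set F) (x y : F) (xs : seq F) (d : nat).

Definition submodule A P : Prop :=
  [/\ P 0, (forall x y, P x -> P y -> P (x + y))
    & (forall a x, A a -> P x -> P (a * x))].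

Definition prime_ideal A P : Prop :=
  [/\ P `<=` A, submodule A P, ~ P 1
    & forall x y, A x -> A y -> P (x * y) -> P x \/ P y].

Definition annihilator A L J : set F :=
  [set a | A a /\ forall x, L x -> J (a * x)].

(** [Q 0 `<` Q 1 `<` ... `<` Q d] are primes of [A] containing the annihilator
    of [L / J]; only the values of [Q] up to [d] matter. *)
Definition prime_chain A L J d (Q : nat -> set F) : Prop :=
  (forall i, (i <= d)%N ->
     prime_ideal A (Q i) /\ annihilator A L J `<=` Q i) /\
  (forall i, (i < d)%N -> Q i `<` Q i.+1).

(** [dim (L / J) = d], i.e. the Krull dimension of [A / Ann (L / J)].  The zero
    module and modules of infinite dimension satisfy this for no [d]. *)
Definition krull_dim A L J d : Prop :=
  (exists Q, prime_chain A L J d Q) /\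
  (forall e Q, prime_chain A L J e Q -> (e <= d)%N).

Definition nonzerodivisor_on L J x : Prop :=
  forall y, L y -> J (x * y) -> J y.

(** [J + x L], so that [L / add_mul L J x] is [(L / J) / x (L / J)]. *)
Definition add_mul L J x : set F :=
  [set y | exists z w, [/\ J z, L w & y = z + x * w]].

Fixpoint regular_seq L J xs : Prop :=
  if xs is x :: xs' then
    nonzerodivisor_on L J x /\ regular_seq L (add_mul L J x) xs'
  else ~ (L `<=` J).

(** [depth (L / J) = d] over a local ring with maximal ideal [m]. *)
Definition depth m L J d : Prop :=
  (exists xs, [/\ size xs = d, (forall x, x \in xs -> m x)
                & regular_seq L J xs]) /\
  (forall xs, (forall x, x \in xs -> m x) -> regular_seq L J xs ->
     (size xs <= d)%N).

(** To be used when [A] is a local ring with maximal ideal [m]. *)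
Definition local_cohen_macaulay A m L J : Prop :=
  exists d, krull_dim A L J d /\ depth m L J d.

Definition ideal P : Prop := submodule setT P.

Definition maximal_ideal m : Prop :=
  [/\ ideal m, ~ m 1
    & forall N, ideal N -> m `<=` N -> ~ N 1 -> N `<=` m].

Definition ideal_gen (E : set F) : set F := smallest ideal E.

End Subquotients.

Section CohenMacaulay.
Variable R : idomainType.
Implicit Types p L J I : set R.

(** The localization of [L] at the prime [p], inside the field of fractions;
    localization being exact, [localize p L / localize p J] is the
    localization of [L / J]. *)
Definition localize p L : set {fraction R} :=
  [set x | exists a s, [/\ L a, ~ p s & x = tofrac a / tofrac s]].

Definition cohen_macaulay L J : Prop :=
  forall m, maximal_ideal m ->
    ~ (localize m L `<=` localize m J) ->
    local_cohen_macaulay (localize m setT) (localize m m)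
                         (localize m L) (localize m J).

(** [R / I] has a Cohen-Macaulay filtration
    [I = C 0 `<` C 1 `<` ... `<` C r = R] with [d j = dim (C j.+1 / C j)].
    The case [r = 0] is [R / I = 0]. *)
Definition sequentially_cohen_macaulay I : Prop :=
  exists (r : nat) (C : nat -> set R) (d : nat -> nat),
  [/\ C 0%N = I, C r = setT,
      (forall j, (j <= r)%N -> ideal (C j)),
      (forall j, (j < r)%N ->
         [/\ C j `<` C j.+1, cohen_macaulay (C j.+1) (C j)
           & krull_dim setT (C j.+1) (C j) (d j)])
    & (forall j, (j.+1 < r)%N -> (d j < d j.+1)%N)].

End CohenMacaulay.

Section ForestType.
Variable n : nat.
Implicit Types (u v w : 'X_{1..n}) (A G H : {fset 'X_{1..n}}).

Definition mgcd u v : 'X_{1..n} := [multinom minn (u i) (v i) | i < n].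

Definition leaf A u : Prop :=
  u \in A /\
  (A = [fset u]%fset \/
   exists v, [/\ v \in A, v != u
     & forall w, w \in A -> w != u -> (mgcd u w <= mgcd u v)%MM]).

Variable K : fieldType.
Implicit Type I : set {mpoly K[n]}.

Definition monomial_gen (E : set 'X_{1..n}) : set {mpoly K[n]} :=
  ideal_gen [set 'X_[m] | m in E].

Definition monomial_ideal I : Prop := exists E, I = monomial_gen E.

(** [G] is the minimal set of monomial generators of [I]. *)
Definition minimal_generators I G : Prop :=
  I = monomial_gen [set` G] /\
  (forall H, {subset H <= G} -> I = monomial_gen [set` H] -> H = G).

Definition forest_type I : Prop :=
  exists2 G, minimal_generators I G &
    forall A, A != fset0 -> {subset A <= G} -> exists u, leaf A u.

End ForestType.

(* Main.v *)
(** For a monomial ideal [I] and an integer [d], let [D_d] be the largest ideal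
    containing [I] with [dim (D_d / I) < d]; it is spanned by the monomials [m]
    with [dim (S / (I : m)) < d].  The chain of the [D_d], without repetitions,
    is a Cohen-Macaulay filtration of [S / I] as soon as each [D_(d+1) / D_d] is
    filtered by shifted copies of quotients [S / P] with [P] generated by all
    but [d] of the variables.

    For an ideal of forest type such filtrations are found by induction.  If
    [u] is a leaf with branch [v] and [g = gcd (u, v)], then [I : g] and
    [(I, g)] are again of forest type, and the filtrations of [S / (I : g)],
    shifted by [g], and of [S / (I, g)] fit together, because
    [dim (S / (I : g r)) <= dim (S / ((I, g) : m))] whenever [m] divides [g r]
    and [g] does not divide [m].  If [g = 1], a variable dividing [u] plays the
    role of [g].

    A module [M] filtered by such [S / P] is Cohen-Macaulay of dimension [d].
    Prime chains over [M] have length at most [d], since [d + 1] elements of a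
    polynomial ring in [d] variables are algebraically dependent.  Let [m] be a
    maximal ideal.  By the Nullstellensatz it contains nonzero polynomials
    [f_k(x_k)], which can be taken to be [x_k] if [x_k] is in [m].  The
    elementary symmetric polynomials of degrees [d], ..., [1] in the [f_k(x_k)]
    form a regular sequence on [S / P] for every [P] contained in [m], hence on
    [M_m]. *)

Require Import Defs.
From HB Require Import structures.
From mathcomp Require Import all_boot all_order all_algebra finmap.
From mathcomp Require Import boolp classical_sets.
From mathcomp Require Import mpoly zify ring.

Set Implicit Arguments.
Unset Strict Implicit.
Unset Printing Implicit Defensive.

Import GRing.Theory.

Local Open Scope ring_scope.
Local Open Scope classical_set_scope.

(** * Regular sequences *)

Section RegularSequences.
Variable F : comNzRingType.
Implicit Types (A J L N P Q : set F) (x y c : F) (xs : seq F).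

Definition subring A : Prop :=
  [/\ A 1, (forall x y, A x -> A y -> A (x - y))
    & forall x y, A x -> A y -> A (x * y)].

Lemma subring_setT : subring setT. Proof. by []. Qed.

Lemma subring0 A : subring A -> A 0.
Proof. by case=> A1 AB _; rewrite -(subrr 1); apply: AB. Qed.

Lemma subringN A x : subring A -> A x -> A (- x).
Proof. by move=> sA Ax; rewrite -sub0r; case: (sA) => _ AB _; apply: AB (subring0 sA) Ax. Qed.

Lemma subringD A x y : subring A -> A x -> A y -> A (x + y).
Proof.
by move=> sA Ax Ay; rewrite -(opprK y); case: (sA) => _ AB _; apply: AB Ax (subringN sA Ay).
Qed.

Lemma subringX A x k : subring A -> A x -> A (x ^+ k).
Proof.
case=> A1 _ AM Ax; elim: k => [|k IHk]; rewrite ?expr0 // exprS; exact: AM.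
Qed.

Lemma subring_submodule A : subring A -> submodule A A.
Proof.
move=> sA; split; first exact: subring0.
- by move=> x y; apply: subringD.
- by case: sA.
Qed.

Lemma submoduleN A P x : subring A -> submodule A P -> P x -> P (- x).
Proof.
move=> sA [_ _ PM] Px; rewrite -mulN1r; apply: PM Px.
by apply: subringN => //; case: sA.
Qed.

Lemma submoduleB A P x y : subring A -> submodule A P -> P x -> P y -> P (x - y).
Proof. by move=> sA sP Px Py; case: (sP) => _ PD _; apply: PD Px (submoduleN sA sP Py). Qed.

Lemma submodule_sum A P (I : Type) (r : seq I) (p : pred I) (f : I -> F) :
  submodule A P -> (forall i, p i -> P (f i)) -> P (\sum_(i <- r | p i) f i).
Proof. by case=> P0 PD _ Pf; elim/big_ind: _. Qed.

Lemma add_mul_submodule A L J x :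
  submodule A L -> submodule A J -> submodule A (add_mul L J x).
Proof.
move=> [L0 LD LM] [J0 JD JM]; split.
- by exists 0, 0; split; rewrite // mulr0 addr0.
- move=> _ _ [j [l [Jj Ll ->]]] [j' [l' [Jj' Ll' ->]]].
  by exists (j + j'), (l + l'); split; [exact: JD|exact: LD|ring].
- move=> a _ Aa [j [l [Jj Ll ->]]].
  by exists (a * j), (a * l); split; [exact: JM|exact: LM|ring].
Qed.

Lemma sub_add_mul A L J x : submodule A L -> J `<=` add_mul L J x.
Proof. by move=> [L0 _ _] y Jy; exists y, 0; split; rewrite // mulr0 addr0. Qed.

Lemma add_mul_sub A L J x : A x ->
  submodule A L -> J `<=` L -> add_mul L J x `<=` L.
Proof.
by move=> Ax [_ LD LM] JL _ [j [l [Jj Ll ->]]]; apply: LD (JL _ Jj) (LM _ _ Ax Ll).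
Qed.

Lemma add_mul_mono L J N x : J `<=` N -> add_mul L J x `<=` add_mul L N x.
Proof. by move=> JN _ [j [l [Jj Ll ->]]]; exists j, l; split=> //; apply: JN. Qed.

Lemma add_mulAC L M J x y :
  add_mul L (add_mul M J x) y = add_mul M (add_mul L J y) x.
Proof.
by apply/seteqP; split=> _ [_ [l [[j [l' [Jj Ll' ->]]] Ll ->]]];
  (eexists; exists l'; split;
    [by exists j, l; split | by [] | by rewrite addrAC]).
Qed.

(** The half of [regular_seq] that passes to extensions of modules; that the last quotient is
    nonzero is proved separately. *)
Fixpoint weakly_regular L J xs : Prop :=
  if xs is x :: xs' then
    nonzerodivisor_on L J x /\ weakly_regular L (add_mul L J x) xs'
  else True.

Definition add_muls L J xs : set F := foldl (add_mul L) J xs.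

Lemma regular_seqE L J xs :
  regular_seq L J xs <-> weakly_regular L J xs /\ ~ (L `<=` add_muls L J xs).
Proof.
elim: xs J => [|x xs IHxs] J /=; first by split=> [|[]].
by split=> [[? /IHxs[]]|[[? ?] ?]]; split=> //; apply/IHxs.
Qed.

Lemma add_muls_mono L J N xs : J `<=` N -> add_muls L J xs `<=` add_muls L N xs.
Proof. by elim: xs J N => //= x xs IHxs J N /(add_mul_mono (L := L) (x := x))/IHxs. Qed.

Lemma add_muls_sub L J P xs : (forall y z, P y -> P z -> P (y + z)) ->
    J `<=` P -> (forall x l, x \in xs -> L l -> P (x * l)) ->
  add_muls L J xs `<=` P.
Proof.
move=> PD; elim: xs J => //= x xs IHxs J JP Pxs; apply: IHxs.
  by move=> _ [j [l [Jj Ll ->]]]; apply: PD; [exact: JP|apply: Pxs; rewrite ?mem_head].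
by move=> y l yxs; apply: Pxs; rewrite inE yxs orbT.
Qed.

(* The hypotheses on [c], [N1], [J1] say that multiplication by [c] identifies
   [N1 / J1] with the submodule [(J + c N1) / J] of [L / J]. *)
Lemma weakly_regular_ext A L J N1 J1 c xs :
    subring A -> (forall x, x \in xs -> A x) ->
    submodule A L -> submodule A J -> submodule A N1 -> J `<=` L ->
    (forall y, N1 y -> L (c * y)) ->
    (forall y, J1 y -> J (c * y)) -> (forall y, N1 y -> J (c * y) -> J1 y) ->
  weakly_regular N1 J1 xs -> weakly_regular L (add_mul N1 J c) xs ->
  weakly_regular L J xs.
Proof.
move=> sA Axs sL sJ sN1 JL N1L; move: sJ JL Axs; elim: xs J J1 => //= x xs IHxs J J1.
move=> sJ JL Axs J1J JJ1 [nzd1 reg1] [nzd2 reg2].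
have Ax : A x by apply: Axs; rewrite mem_head.
have [N10 N1D N1M] := sN1; have [J0 JD JM] := sJ; have [L0 LD LM] := sL.
(* On the cokernel [L / (J + c N1)] the element [x] can be cancelled. This yields both that [x] is a
   nonzerodivisor on [L / J] and that multiplication by [c] stays injective modulo [x]. *)
have inJc l : L l -> add_mul N1 J c (x * l) -> exists j n, [/\ J j, N1 n & l = j + c * n].
  by move=> Ll /(nzd2 _ Ll).
split.
  move=> y Ly Jxy; have [|j [n [Jj N1n y_eq]]] := inJc y Ly.
    by exists (x * y), 0; split; rewrite // mulr0 addr0.
  rewrite y_eq; apply: JD => //; apply: J1J; apply: nzd1 => //; apply: JJ1; first exact: N1M.
  have -> : c * (x * n) = x * y - x * j by rewrite y_eq; ring.
  by apply: (submoduleB sA) => //; apply: JM.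
apply: (IHxs _ (add_mul N1 J1 x)) => //.
- exact: add_mul_submodule.
- exact: (add_mul_sub Ax sL).
- by move=> y yxs; apply: Axs; rewrite inE yxs orbT.
- move=> _ [j [n [J1j N1n ->]]]; exists (c * j), (c * n).
  by split; [exact: J1J|exact: N1L|ring].
- move=> n N1n [j [l [Jj Ll cn_eq]]].
  have [|j' [n' [Jj' N1n' l_eq]]] := inJc l Ll.
    exists (- j), n; split=> //; last by rewrite cn_eq; ring.
    exact: submoduleN sJ Jj.
  exists (n - x * n'), n'; split=> //; last by ring.
  apply: JJ1; first by apply: (submoduleB sA) => //; apply: N1M.
  have -> : c * (n - x * n') = j + x * j' by rewrite mulrBr cn_eq l_eq; ring.
  by apply: JD => //; apply: JM.
- by rewrite add_mulAC.
Qed.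

Lemma weakly_regular_zero A L J xs : submodule A L -> L `<=` J -> weakly_regular L J xs.
Proof.
move=> sL; elim: xs J => //= x xs IHxs J LJ; split; first by move=> y /LJ.
by apply: IHxs => y /LJ; apply: (@sub_add_mul A L J x sL y).
Qed.

End RegularSequences.

Arguments submodule_sum {F A P I r p f}.

(** * Prime chains *)

Section PrimeChains.
Variable F : comNzRingType.
Implicit Types (A J L P I M : set F) (x y : F) (xs : seq F).

(** An ideal [X] maximal among those containing [I] and avoiding [M] is prime: if [x] and [y] are
    outside, [X + x A] and [X + y A] both meet [M], and so would [X] if it contained [x * y]. *)
Lemma prime_ideal_disjoint A I M : subring A -> submodule A I -> I `<=` A ->
    M `<=` A -> M 1 -> (forall x y, M x -> M y -> M (x * y)) ->
    (forall x, I x -> ~ M x) ->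
  exists P, [/\ prime_ideal A P, I `<=` P & forall x, P x -> ~ M x].
Proof.
move=> sA sI IA MA M1 MM IM.
pose good X := [/\ submodule A X, I `<=` X, X `<=` A & forall x, X x -> ~ M x].
have [|X [goodX Xmax]] := @Zorn_bigcup F [set X | X = set0 \/ good X].
  move=> /= C Cgood Ctot.
  have [[X0 [CX0 X00]]|C0] := pselect (exists X, C X /\ X <> set0); last first.
    left; apply/seteqP; split=> // x [X CX Xx].
    suff Xe : X = set0 by rewrite Xe in Xx.
    by apply: contrapT => Xe; apply: C0; exists X.
  have {}Cgood X x : C X -> X x -> good X.
    by move=> CX Xx; case: (Cgood X CX) => // Xe; rewrite Xe in Xx.
  have [x0 X0x0] : exists x, X0 x.
    apply: contrapT => X0e; apply: X00; apply/seteqP; split=> // x X0x.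
    by apply: X0e; exists x.
  have [[X0_0 _ _] IX0 _ _] := Cgood _ _ CX0 X0x0.
  right; split.
  - split; first by exists X0.
    + move=> x y [X CX Xx] [Y CY Yy].
      have [[_ XD _] _ _ _] := Cgood _ _ CX Xx; have [[_ YD _] _ _ _] := Cgood _ _ CY Yy.
      have [XY|YX] := Ctot _ _ CX CY; first by exists Y => //; apply: YD => //; apply: XY.
      by exists X => //; apply: XD => //; apply: YX.
    + move=> a x Aa [X CX Xx]; exists X => //.
      by have [[_ _ XM] _ _ _] := Cgood _ _ CX Xx; apply: XM.
  - by move=> x /IX0 X0x; exists X0.
  - by move=> x [X CX Xx]; have [_ _ XA _] := Cgood _ _ CX Xx; apply: XA.
  - by move=> x [X CX Xx]; have [_ _ _ XM] := Cgood _ _ CX Xx; apply: XM.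
have {goodX} [sX IX XA XM] : good X.
  case: goodX => // X0; exfalso; apply: (Xmax I); last by right; split.
  by rewrite X0; split=> // I0; case: sI => Iz _ _; apply: (I0 0).
exists X; split=> //; split=> //; first by move=> /XM.
move=> x y Ax Ay Xxy.
have meets z : A z -> ~ X z -> exists p a, [/\ X p, A a & M (p + z * a)].
  move=> Az Xz; apply: contrapT => noM; apply: (Xmax (add_mul A X z)).
    split; first by apply: sub_add_mul (subring_submodule sA).
    move=> /(_ z) zX; apply: Xz; apply: zX; exists 0, 1.
    by case: sX => ? _ _; case: sA => ? _ _; split; rewrite // mulr1 add0r.
  rewrite /=; right; split.
  - by apply: add_mul_submodule => //; apply: subring_submodule.
  - by apply: subset_trans IX _; apply: sub_add_mul (subring_submodule sA).
  - exact: add_mul_sub Az (subring_submodule sA) XA.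
  - by move=> _ [p [a [Xp Aa ->]]] Mpa; apply: noM; exists p, a.
apply: contrapT => /not_orP[Xx Xy].
have [p [a [Xp Aa Mpa]]] := meets x Ax Xx.
have [q [b [Xq Ab Mqb]]] := meets y Ay Xy.
apply: (XM _ _ (MM _ _ Mpa Mqb)).
have [X0 XD Xmul] := sX; have [_ _ Amul] := sA.
have -> : (p + x * a) * (q + y * b) = q * p + (y * b) * p + (x * a) * q + (a * b) * (x * y).
  by ring.
by apply: (XD); [apply: (XD); [apply: (XD)|]|]; apply: (Xmul) => //;
  try (apply: (Amul) => //); apply: XA.
Qed.

Lemma annihilator_submodule A L J : subring A -> submodule A J ->
  submodule A (annihilator A L J).
Proof.
move=> sA [J0 JD JM]; split.
- by split; [exact: subring0|move=> x _; rewrite mul0r].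
- move=> a b [Aa aL] [Ab bL]; split; first exact: subringD.
  by move=> x Lx; rewrite mulrDl; apply: JD; [apply: aL|apply: bL].
- move=> a b Aa [Ab bL]; split; first by case: sA => _ _; apply.
  by move=> x Lx; rewrite -mulrA; apply: JM => //; apply: bL.
Qed.

(* If [x] is a nonzerodivisor on [L / J], every prime containing
   [Ann (L / (J + x L))] strictly contains a prime containing [Ann (L / J)]. *)
Lemma regular_seq_prime_chain A L J xs : subring A -> submodule A L ->
    submodule A J -> (forall x, x \in xs -> A x) -> regular_seq L J xs ->
  exists Q, prime_chain A L J (size xs) Q.
Proof.
move=> sA sL; elim: xs J => [|x xs IHxs] J sJ Axs /=.
  move=> LJ; have [|||||x [_ annx] x1|P [primeP IP _]] :=
    @prime_ideal_disjoint A (annihilator A L J) [set 1] sA.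
  - exact: annihilator_submodule.
  - by move=> x [].
  - by move=> _ ->; case: sA.
  - by [].
  - by move=> x y -> ->; rewrite mulr1.
  - by apply: LJ => y /annx; rewrite x1 mul1r.
  - by exists (fun=> P); split.
have Ax : A x by apply: Axs; rewrite mem_head.
have {}Axs y : y \in xs -> A y by move=> yxs; apply: Axs; rewrite inE yxs orbT.
case=> nzdx /(IHxs _ (add_mul_submodule x sL sJ) Axs)[Q [primeQ ltQ]].
have [[QA sQ Q1 Qprime] annQ] := primeQ 0%N isT.
(* A prime avoiding [M] lies in [Q 0] (take [k = 0]) and misses [x] (take [s = 1]), whereas [x] is
   in [Q 0] because it kills [L / (J + x L)]. *)
pose M := [set y | exists s k, [/\ A s, ~ Q 0%N s & y = s * x ^+ k]].
have nzdX k y : L y -> J (x ^+ k * y) -> J y.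
  have [_ _ LM] := sL.
  elim: k y => [|k IHk] y Ly; first by rewrite mul1r.
  by rewrite exprSr -mulrA => /(IHk _ (LM _ _ Ax Ly)); apply: nzdx.
have [|||||y [_ anny] [s [k [As Qs y_eq]]]|] :=
  @prime_ideal_disjoint A (annihilator A L J) M sA.
- exact: annihilator_submodule.
- by move=> y [].
- by move=> _ [s [k [As _ ->]]]; case: (sA) => _ _; apply=> //; apply: subringX.
- by exists 1, 0%N; split=> //; [case: sA|rewrite mulr1].
- move=> _ _ [s [k [As Qs ->]]] [t [l [At Qt ->]]].
  exists (s * t), (k + l)%N; split; last by rewrite exprD; ring.
    by case: sA => _ _; apply.
  by move=> /(Qprime _ _ As At)[].
(* If [s * x ^+ k] kills [L / J], so does [s], because [x] is a nonzerodivisor; then [s] would be in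
   [Q 0]. *)
- apply: Qs; apply: annQ; split=> // l Ll.
  apply: (@sub_add_mul _ A L J x sL); apply: (nzdX k).
    by case: sL => _ _; apply.
  by rewrite mulrA (mulrC _ s) -y_eq; apply: anny.
move=> P [primeP annP PM]; exists (fun i => if i is i'.+1 then Q i' else P).
have PQ : P `<=` Q 0%N.
  move=> y Py; apply: contrapT => Qy; apply: (PM y Py).
  by exists y, 0%N; split; rewrite ?mulr1 //; case: primeP => PA _ _ _; apply: PA.
have annJ : annihilator A L J `<=` annihilator A L (add_mul L J x).
  by move=> a [Aa aL]; split=> // y /aL; apply: (@sub_add_mul _ A L J x sL).
split=> [[|i]|[|i]] //=.
- rewrite ltnS => /primeQ[primeQi annQi]; split=> //; exact: subset_trans annJ annQi.
- move=> _; split=> // QP; apply: (PM x).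
    apply: QP; apply: annQ; split=> // y Ly.
    by exists 0, y; split; rewrite ?add0r //; case: sJ.
  by exists 1, 1%N; split; rewrite ?mul1r //; case: sA.
- by rewrite ltnS; apply: ltQ.
Qed.

End PrimeChains.

(** * Elementary symmetric polynomials *)

Section ElementarySymmetric.
Variables (F : comNzRingType) (n : nat) (y : 'I_n -> F).
Implicit Types (W : {set 'I_n}) (J : set F).

Definition esym d : F := \sum_(T : {set 'I_n} | #|T| == d) \prod_(k in T) y k.

(** This is the prime [P] of the variables outside [W] when the [y k] are the variables; only the
    values of [a] off [W] matter. *)
Definition compl_ideal W : set F :=
  [set p | exists a : 'I_n -> F, p = \sum_(k | k \notin W) a k * y k].

Lemma compl_ideal_submodule W : submodule setT (compl_ideal W).
Proof.
split.
- by exists (fun=> 0); rewrite big1 // => k _; rewrite mul0r.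
- move=> _ _ [a ->] [b ->]; exists (fun k => a k + b k).
  by rewrite -big_split; apply: eq_bigr => k _; rewrite mulrDl.
- move=> c _ _ [a ->]; exists (fun k => c * a k).
  by rewrite mulr_sumr; apply: eq_bigr => k _; rewrite mulrA.
Qed.

Lemma compl_ideal_gen W k : k \notin W -> compl_ideal W (y k).
Proof.
move=> kW; exists (fun j => (j == k)%:R).
rewrite (bigD1 k) //= eqxx mul1r big1 ?addr0 // => j /andP[_ /negPf->].
by rewrite mul0r.
Qed.

Lemma compl_idealD1 W k : k \in W ->
  compl_ideal (W :\ k) = add_mul setT (compl_ideal W) (y k).
Proof.
move=> kW; have DW (a : 'I_n -> F) : \sum_(j | j \notin W :\ k) a j * y j =
    \sum_(j | j \notin W) a j * y j + y k * a k.
  rewrite (bigD1 k) ?inE ?eqxx //= addrC mulrC; congr (_ + _).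
  by apply: eq_bigl => j; rewrite !inE; case: eqP => [->|_]; rewrite ?kW ?andbF ?andbT.
apply/seteqP; split=> [_ [a ->]|_ [_ [w [[a ->] _ ->]]]].
  by rewrite DW; eexists; exists (a k); split; [exists a; reflexivity| |].
exists (fun j => if j == k then w else a j); rewrite DW eqxx; congr (_ + _).
by apply: eq_bigr => j jW; case: eqP => // jk; rewrite jk kW in jW.
Qed.

(** A set [T] of the same size as [W] but different from it contains some [k] outside [W], so its
    product vanishes modulo the ideal. *)
Lemma esym_compl_ideal W : compl_ideal W (esym #|W| - \prod_(k in W) y k).
Proof.
rewrite /esym (bigD1 W) //= addrC addrK.
apply: (submodule_sum (compl_ideal_submodule W)) => T /andP[/eqP cardT TW].
have /subsetPn[k kT kW] : ~~ (T \subset W).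
  by apply: contraNN TW => sTW; rewrite eqEcard sTW cardT /=.
rewrite (bigD1 k) //= mulrC; have [_ _ JM] := compl_ideal_submodule W.
by apply: JM => //; apply: compl_ideal_gen.
Qed.

Lemma add_mul_congr J u v : submodule setT J -> J (u - v) ->
  add_mul setT J u = add_mul setT J v.
Proof.
move=> [J0 JD JM]; have sub a b : J (a - b) -> add_mul setT J a `<=` add_mul setT J b.
  move=> Jab _ [j [l [Jj _ ->]]]; exists (j + l * (a - b)), l.
  by split=> //; [apply: JD => //; apply: JM|ring].
move=> Juv; apply/seteqP; split; apply: sub => //.
by rewrite -opprB -mulN1r; apply: JM.
Qed.

Hypothesis nzd_y :
  forall W k, k \in W -> nonzerodivisor_on setT (compl_ideal W) (y k).

Lemma nzd_prod W (s : seq 'I_n) : {subset s <= W} ->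
  nonzerodivisor_on setT (compl_ideal W) (\prod_(k <- s) y k).
Proof.
elim: s => [|k s IHs] sW p _; first by rewrite big_nil mul1r.
rewrite big_cons -mulrA => /(nzd_y (sW k (mem_head _ _)) I).
by apply: IHs => // j js; apply: sW; rewrite inE js orbT.
Qed.

(* The sequence is taken with decreasing indices: on [F / compl_ideal W] the
   top one acts as the product of the [y k], [k \in W], and modulo that product
   the module is filtered by the [F / compl_ideal (W :\ k)], on which the other
   ones are again the elementary symmetric polynomials. *)
Lemma esym_weakly_regular W :
  weakly_regular setT (compl_ideal W) [seq esym j | j <- rev (iota 1 #|W|)].
Proof.
move cardW: #|W| => d; elim: d => // d IHd in W cardW *.
rewrite -(addn1 d) iotaD cats1 rev_rcons add1n /=.
have := esym_compl_ideal W; rewrite cardW => eW.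
have sT := subring_submodule (subring_setT F).
have sJ W' := compl_ideal_submodule W'.
have [J0 JD JM] := sJ W.
have nzdW : nonzerodivisor_on setT (compl_ideal W) (\prod_(k in W) y k).
  by rewrite -big_enum; apply: nzd_prod => k; rewrite mem_enum.
split.
  move=> p _ ep; apply: nzdW => //.
  have -> : (\prod_(k in W) y k) * p = esym d.+1 * p + - p * (esym d.+1 - \prod_(k in W) y k).
    by ring.
  by apply: (JD) => //; apply: (JM).
rewrite (add_mul_congr (sJ W) eW) -big_enum /=.
have: {subset enum W <= W} by move=> k; rewrite mem_enum.
(* The factors are peeled off one at a time. With [c] the product over [s], the submodule generated
   by [c] modulo [y k * c] is a copy of [F / compl_ideal (W :\ k)], covered by [IHd]; the quotient
   is the case of the shorter product [c]. *)
elim: (enum W) => [|k s IHs] sW.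
  rewrite big_nil; apply: weakly_regular_zero sT _ => p _.
  by exists 0, p; split; rewrite // mul1r add0r.
have kW : k \in W by apply: sW; rewrite mem_head.
have {}sW : {subset s <= W} by move=> j js; apply: sW; rewrite inE js orbT.
rewrite big_cons; set c := \prod_(j <- s) y j.
have Jk := compl_idealD1 kW.
apply: (@weakly_regular_ext _ setT _ _ setT (compl_ideal (W :\ k)) c) => //.
- exact: add_mul_submodule.
- rewrite Jk => _ [j [l [Jj _ ->]]]; exists (c * j), l.
  by split=> //; [exact: JM|ring].
- move=> p _ [j [l [Jj _ cp]]]; rewrite Jk; exists (p - y k * l), l; split=> //; last by ring.
  apply: (nzd_prod sW) => //; rewrite -/c.
  by have -> : c * (p - y k * l) = j by rewrite mulrBr cp; ring.
- by apply: IHd; move: cardW; rewrite (cardsD1 k) kW => -[].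
- suff -> : add_mul setT (add_mul setT (compl_ideal W) (y k * c)) c =
            add_mul setT (compl_ideal W) c by apply: IHs.
  apply/seteqP; split=> _ [j [l [Jj _ ->]]]; last first.
    by exists j, l; split=> //; apply: (@sub_add_mul _ setT).
  have [j' [l' [Jj' _ ->]]] := Jj; exists j', (y k * l' + l).
  by split=> //; ring.
Qed.

End ElementarySymmetric.

(** * Prime filtrations of monomial ideals *)

Lemma leq_sum_seq (T : eqType) (s : seq T) (f1 f2 : T -> nat) :
  (forall a, a \in s -> f1 a <= f2 a)%N ->
  (\sum_(a <- s) f1 a <= \sum_(a <- s) f2 a)%N.
Proof. by move=> f12; rewrite !big_seq; apply: leq_sum. Qed.

Lemma ltn_sum_seq (T : eqType) (s : seq T) (f1 f2 : T -> nat) (u : T) :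
    (forall a, a \in s -> f1 a <= f2 a)%N -> u \in s -> (f1 u < f2 u)%N ->
  (\sum_(a <- s) f1 a < \sum_(a <- s) f2 a)%N.
Proof.
move=> f12 us lt_u; rewrite !(big_rem u us) /= -addSn leq_add // leq_sum_seq // => a.
by move/mem_rem; apply: f12.
Qed.

Section MonomialFiltrations.
Variable n : nat.
Implicit Types (U W N B I A : set 'X_{1..n}) (m w t r u g a b c : 'X_{1..n}).
Implicit Types (Z : {set 'I_n}) (d : nat).

Local Notation "[>= g ]" := [set m | (g <= m)%MM] (format "[>= g ]").

(** The monomials of the prime ideal generated by the variables outside [Z]. *)
Definition outside Z w : bool := [exists k, (k \notin Z) && (0 < w k)%N].

Lemma outsideP Z w : reflect (exists2 k, k \notin Z & (0 < w k)%N) (outside Z w).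
Proof. by apply: (iffP existsP) => [[k /andP[]]|[k kZ wk]]; exists k; rewrite ?kZ. Qed.

Lemma outside0 Z : outside Z 0%MM = false.
Proof. by apply/outsideP => -[k _]; rewrite mnm0E. Qed.

Lemma outsideD Z w t : outside Z (w + t)%MM = outside Z w || outside Z t.
Proof.
apply/outsideP/orP => [[k kZ]|[|]/outsideP[k kZ kP]].
- by rewrite mnmDE addn_gt0 => /orP[] ?; [left|right]; apply/outsideP; exists k.
- by exists k; rewrite // mnmDE addn_gt0 kP.
- by exists k; rewrite // mnmDE addn_gt0 kP orbT.
Qed.

(** For the monomials [I] of a monomial ideal, those of the largest ideal [D]
    with [dim (D / I) < d]: the sets [Z] in the definition are those whose
    variables are independent modulo the colon ideal [I : m]. *)
Definition dim_below I d : set 'X_{1..n} :=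
  [set m | forall Z, (forall w, I (m + w)%MM -> outside Z w) -> (#|Z| < d)%N].

Lemma sub_dim_below I d : I `<=` dim_below I d.
Proof. by move=> m Im Z /(_ 0%MM); rewrite addm0 outside0 => /(_ Im). Qed.

Lemma dim_below_mono I d : dim_below I d `<=` dim_below I d.+1.
Proof. by move=> m Im Z /Im/ltnW. Qed.

(** Chains of monomial ideals with quotients [S / P_Z], [#|Z| = d]. *)
Inductive mfilt d U : set 'X_{1..n} -> Prop :=
| mfilt0 : mfilt d U U
| mfiltS N t Z : mfilt d U N -> #|Z| = d ->
    (forall w, N (t + w)%MM <-> outside Z w) -> mfilt d U (N `|` [>= t]).

Lemma mfilt_sub d U W : mfilt d U W -> U `<=` W.
Proof. by elim=> // {}W t Z _ UW _ _ m /UW; left. Qed.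

Lemma mfilt_trans d U N W : mfilt d U N -> mfilt d N W -> mfilt d U W.
Proof. by move=> UN; elim=> // {}W t Z _ UW cardZ tZ; apply: mfiltS tZ. Qed.

Lemma lem_addE g m : (g <= m)%MM -> exists r, m = (g + r)%MM.
Proof. by move=> gm; exists (m - g)%MM; rewrite addmC submK. Qed.

(** As [U] is the colon of [B] by [g], multiplication by [g] embeds the quotient by [U] into the
    quotient by [B]; a layer at [t] becomes a layer at [g + t] with the same [Z]. *)
Lemma mfilt_shift d g B U W : (forall m, B (g + m)%MM <-> U m) -> mfilt d U W ->
  mfilt d B (B `|` [set m | exists2 r, W r & m = (g + r)%MM]).
Proof.
move=> BU; elim=> [|{}W t Z UW IH cardZ tZ].
  rewrite (_ : _ `|` _ = B); first exact: mfilt0.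
  by apply/seteqP; split=> [m [//|[r Ur ->]]|m]; [apply/BU|left].
set W' := _ `|` _ in IH.
have -> : B `|` [set m | exists2 r, (W `|` [>= t]) r & m = (g + r)%MM] =
          W' `|` [>= (g + t)%MM].
  apply/seteqP; split=> m.
    case=> [Bm|[r [Wr|tr] ->]]; [by left; left|by left; right; exists r|right].
    by apply/mnm_lepP => i; rewrite !mnmDE leq_add2l; apply/mnm_lepP.
  case=> [[Bm|[r Wr ->]]|/lem_addE[r ->]]; [by left|by right; exists r => //; left|right].
  by exists (t + r)%MM; rewrite ?addmA //; right; apply: lem_addr.
apply: mfiltS IH cardZ _ => w; rewrite -tZ -addmA; split=> [[|[r Wr /addmI ->//]]|Wtw].
  by move=> /BU /(mfilt_sub UW).
by right; exists (t + w)%MM.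
Qed.

(** Every layer sits at some [t] not divisible by [g], as [U] contains all multiples of [g]. The
    multiples of [t] divisible by [g] already lie in [B], so adding [t] over [B] gives the same
    colon, hence the same [Z]. *)
Lemma mfilt_avoid d g B U W : [>= g] `<=` U ->
    (forall m, ~~ (g <= m)%MM -> B m <-> U m) ->
    (forall m r, ~~ (g <= m)%MM -> W m -> (g <= m + r)%MM -> B (m + r)%MM) ->
  mfilt d U W -> mfilt d B (B `|` (W `&` [set m | ~~ (g <= m)%MM])).
Proof.
move=> gU BU BW UW; elim: UW BW => [|{}W t Z UW IH cardZ tZ] BW.
  rewrite (_ : _ `|` _ = B); first exact: mfilt0.
  by apply/seteqP; split=> [m [//|[Um /= gm]]|m]; [apply/BU|left].
have {}IH : mfilt d B (B `|` (W `&` [set m | ~~ (g <= m)%MM])).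
  by apply: IH => m r gm Wm; apply: BW => //; left.
set W' := _ `|` _ in IH.
have gW m : (g <= m)%MM -> W m by move=> /gU; apply: mfilt_sub UW m.
have gt : ~~ (g <= t)%MM.
  by apply/negP => /gW; rewrite -[t]addm0 => /tZ; rewrite outside0.
have Bt w : (g <= t + w)%MM -> B (t + w)%MM.
  by apply: BW => //; right; apply: lepm_refl.
rewrite (_ : B `|` _ = W' `|` [>= t]).
  apply: mfiltS IH cardZ _ => w; rewrite -tZ.
  have [gtw|gtw] := boolP (g <= t + w)%MM.
    by split=> _; [apply: gW|left; apply: Bt].
  split=> [[/(BU _ gtw)/(mfilt_sub UW)//|[]//]|Wtw].
  by right.
apply/seteqP; split=> m.
  by case=> [Bm|[[Wm|tm] gm]]; [left; left|left; right|right].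
case=> [[Bm|[Wm gm]]|/lem_addE[r ->]]; [by left|by right; split=> //; left|].
have [/Bt|gtr] := boolP (g <= t + r)%MM; first by left.
by right; split=> //; right; apply: lem_addr.
Qed.

Definition upset A : set 'X_{1..n} := [set m | exists2 a, A a & (a <= m)%MM].

(** * Splitting a monomial ideal along a divisor of one generator *)

Section Splitting.
Variables (A : set 'X_{1..n}) (u g : 'X_{1..n}).
Hypotheses (Au : A u) (gu : (g <= u)%MM).
Hypothesis gcd_u : forall a, A a -> a != u -> (mgcd u a <= g)%MM.

Local Notation I := (upset A).
Local Notation Ig := (upset A `|` [>= g]).

(* Given [Z] independent modulo [I : g r], some [z] outside [Z] occurs in
   [u / gcd (u, g r)], hence in no [a / gcd (a, g r)] with [a != u], and some
   [i] occurs in [g / gcd (g, m)]; replace [i] by [z]. *)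
Lemma dim_below_shed d m r : ~~ (g <= m)%MM -> (m <= g + r)%MM ->
  dim_below Ig d m -> dim_below I d (g + r)%MM.
Proof.
move=> gm mgr Dm Z indepZ.
have [z zZ uz] : exists2 z, z \notin Z & (g z + r z < u z)%N.
  have /outsideP[z zZ] : outside Z (u - (g + r))%MM.
    apply: indepZ; exists u => //; apply/mnm_lepP => i; rewrite !mnmDE mnmBE mnmDE.
    by rewrite -leq_subLR.
  by rewrite mnmBE mnmDE subn_gt0; exists z.
have az a : A a -> a != u -> (a z <= g z)%N.
  move=> Aa au; have /mnm_lepP/(_ z) := gcd_u Aa au.
  rewrite mnmE geq_min => /orP[|//]; rewrite leqNgt.
  by rewrite (leq_ltn_trans (leq_addr _ _) uz).
have [i mi] : exists i, (m i < g i)%N.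
  by move: gm => /forallPn[i]; rewrite -ltnNge; exists i.
suff : (#|(z |: Z) :\ i| < d)%N.
  apply: leq_ltn_trans; have := cardsD1 i (z |: Z); rewrite cardsU1 zZ /=.
  by case: (i \in z |: Z) => /=; rewrite ?add1n ?add0n; [case=> -> | move=> <-].
apply: Dm => w [[a Aa amw]|gmw]; last first.
  apply/outsideP; exists i; rewrite ?inE ?eqxx //.
  by move/mnm_lepP/(_ i): gmw; rewrite mnmDE; lia.
have [au|au] := eqVneq a u.
  apply/outsideP; exists i; rewrite ?inE ?eqxx //.
  by move/mnm_lepP/(_ i): amw; move/mnm_lepP/(_ i): gu; rewrite au mnmDE; lia.
have /outsideP[k kZ] : outside Z (a - (g + r))%MM.
  apply: indepZ; exists a => //; apply/mnm_lepP => j; rewrite !mnmDE mnmBE mnmDE.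
  by rewrite -leq_subLR.
rewrite mnmBE mnmDE subn_gt0 => grk; apply/outsideP; exists k.
  rewrite !inE (negPf kZ) orbF negb_and negbK; apply/orP; right.
  by apply: contraTneq grk => ->; have := az _ Aa au; lia.
move/mnm_lepP/(_ k): amw; move/mnm_lepP/(_ k): mgr; rewrite !mnmDE; lia.
Qed.

(** Suppose [Z] is independent modulo [I : m] but not modulo [(I, g) : m]. Then a monomial [w] in
    the variables of [Z] makes [m + w] a multiple of [g]; [Z] stays independent modulo
    [I : (m + w)], and [dim_below_shed] bounds it. *)
Lemma dim_below_avoid d m : ~~ (g <= m)%MM -> dim_below I d m <-> dim_below Ig d m.
Proof.
move=> gm; split=> [Dm Z indepZ|Dm Z indepZ]; first by apply: Dm => w Iw; apply: indepZ; left.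
have [indepZ'|/existsNP[w /not_implyP[Igw /negP wZ]]] :=
  pselect (forall w, Ig (m + w)%MM -> outside Z w); first exact: Dm.
case: Igw => [/indepZ|/lem_addE[r mwgr]]; first by rewrite (negPf wZ).
apply: (@dim_below_shed d m r gm _ Dm Z); first by rewrite -mwgr lem_addr.
by move=> s; rewrite -mwgr -addmA => /indepZ; rewrite outsideD (negPf wZ).
Qed.

(** The multiples of [g] are added first, through the shifted filtration of the colon, and the other
    monomials afterwards, through that of [(I, g)]. The divisibility condition of [mfilt_avoid]
    comes from [dim_below_shed]. *)
Lemma mfilt_split :
    (forall d, let I' := [set m | I (g + m)%MM] in
       mfilt d (dim_below I' d) (dim_below I' d.+1)) ->
    (forall d, mfilt d (dim_below Ig d) (dim_below Ig d.+1)) ->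
  forall d, mfilt d (dim_below I d) (dim_below I d.+1).
Proof.
move=> /= IHcolon IHadd d; set I' := [set m | _] in IHcolon.
have colonE e m : dim_below I e (g + m)%MM <-> dim_below I' e m.
  split=> Dm Z indepZ; apply: Dm => w Iw; apply: indepZ.
    by rewrite /I' /= addmA.
  by rewrite -addmA.
apply: mfilt_trans (mfilt_shift (colonE d) (IHcolon d)) _.
set B := _ `|` _.
have BE m : ~~ (g <= m)%MM -> B m <-> dim_below Ig d m.
  move=> gm; rewrite -dim_below_avoid //; split=> [[//|[r _ m_eq]]|]; last by left.
  by rewrite m_eq lem_addr in gm.
have -> : dim_below I d.+1 =
    B `|` (dim_below Ig d.+1 `&` [set m | ~~ (g <= m)%MM]).
  apply/seteqP; split=> m.
    move=> Dm; have [/lem_addE[r m_eq]|gm] := boolP (g <= m)%MM.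
      by left; right; exists r; [|exact: m_eq]; apply: (iffLR (colonE _ _)); rewrite -m_eq.
    by right; split=> //; apply/dim_below_avoid.
  case=> [[/dim_below_mono//|[r Dr ->]]|[Dm gm]]; first exact/colonE.
  exact/dim_below_avoid.
apply: mfilt_avoid BE _ (IHadd d) => [m gm|m s gm Dm /lem_addE[r ms]].
  by apply: sub_dim_below; right.
right; exists r; [|exact: ms]; apply: (iffLR (colonE _ _)); apply: (dim_below_shed gm) Dm.
by rewrite -ms lem_addr.
Qed.

End Splitting.

(** * Forests *)

(** Stated for sequences because passing to [I : g] or [(I, g)] may identify generators. Since
    [mgcd u w] divides [u], it divides [v] exactly when it divides [mgcd u v]. *)
Definition forest (s : seq 'X_{1..n}) : Prop :=
  forall s' : seq 'X_{1..n}, s' != [::] -> {subset s' <= s} -> exists2 u, u \in s' &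
    (forall w, w \in s' -> w = u) \/
    exists v, [/\ v \in s', v != u &
      forall w, w \in s' -> w != u -> (mgcd u w <= v)%MM].

Lemma forest_subset (s s' : seq 'X_{1..n}) :
  forest s -> {subset s' <= s} -> forest s'.
Proof. by move=> fs s's s'' ? s''s'; apply: fs => // w /s''s'/s's. Qed.

Lemma forest_map (f : 'X_{1..n} -> 'X_{1..n}) (s : seq 'X_{1..n}) : forest s ->
    (forall a b c, a \in s -> b \in s -> c \in s -> a != b -> a != c ->
       (mgcd a b <= c)%MM -> (mgcd (f a) (f b) <= f c)%MM) ->
  forest (map f s).
Proof.
(* The function [h] picks one preimage of each element; a leaf of the chosen preimages maps to a
   leaf. *)
move=> fs fP s' s'0 s's; pose h b := nth 0%MM s (index b (map f s)).
have hs b : b \in s' -> h b \in s.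
  by move=> /s's bs; rewrite mem_nth // -(size_map f) index_mem.
have hK b : b \in s' -> f (h b) = b.
  move=> /s's bs; rewrite -(nth_map _ 0%MM) ?nth_index //.
  by rewrite -(size_map f) index_mem.
have [||_ /mapP[b bs' ->] leaf_b] := fs (map h s').
- by case: (s') s'0.
- by move=> _ /mapP[b bs' ->]; apply: hs.
exists b => //; case: leaf_b => [hb|[_ [/mapP[c cs' ->] cb leaf_b]]].
  by left=> w ws'; rewrite -(hK w ws') (hb (h w)) ?hK ?map_f.
right; exists c; split=> //; first by apply: contraNneq cb => ->.
move=> w ws' wb; have hwb : h w != h b.
  by apply: contraNneq wb => /(congr1 f); rewrite !hK // => ->.
by rewrite -(hK b) // -(hK w) // -(hK c) //; apply: fP; rewrite ?hs 1?eq_sym ?leaf_b ?map_f // eq_sym.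
Qed.

(** The variables in [V] are generators already split off; they are kept apart from the forest [s],
    in which they do not occur. *)
Definition forest_gens (s : seq 'X_{1..n}) (V : {set 'I_n}) : set 'X_{1..n} :=
  [set a | a \in s \/ exists2 k, k \in V & a = U_(k)%MM].

(** For a monomial outside this prime the colon is the prime itself, of dimension [#|Z|]. The chain
    therefore jumps once, from the prime to the whole ring, at [d = #|Z|]. *)
Lemma mfilt_prime (Z : {set 'I_n}) d :
  let I := [set m | outside Z m] in mfilt d (dim_below I d) (dim_below I d.+1).
Proof.
move=> I; have DE e : dim_below I e = [set m | outside Z m || (#|Z| < e)%N].
  apply/seteqP; split=> m /=.
    have [//|mZ /= Dm] := boolP (outside Z m); apply: Dm => w.
    by rewrite /I /= outsideD (negPf mZ).
  case/orP=> [mZ|lt_Z]; first exact: sub_dim_below.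
  move=> Z' indepZ'; apply: leq_ltn_trans lt_Z; apply: subset_leq_card; apply/fintype.subsetP => k.
  apply: contraTT => kZ; have /outsideP[j jZ'] : outside Z' U_(k)%MM.
    by apply: indepZ'; rewrite /I /= outsideD; apply/orP; right; apply/outsideP; exists k;
      rewrite // mnm1E eqxx.
  by rewrite mnm1E; case: eqP => // ->.
rewrite !DE; have [<-|neq_d] := eqVneq #|Z| d; last first.
  rewrite (_ : [set m | outside Z m || (#|Z| < d.+1)%N] = [set m | outside Z m || (#|Z| < d)%N]).
    exact: mfilt0.
  by apply/seteqP; split=> m /=; rewrite ltnS [(#|Z| <= d)%N]leq_eqVlt (negPf neq_d).
have -> : [set m | outside Z m || (#|Z| < #|Z|.+1)%N] =
          [set m | outside Z m || (#|Z| < #|Z|)%N] `|` [>= 0%MM].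
  apply/seteqP; split=> m /=; rewrite ltnS leqnn orbT // => _; right.
  by apply/mnm_lepP => i; rewrite mnm0E.
by apply: mfiltS (mfilt0 _ _) _ _ => // w /=; rewrite ltnn orbF add0m.
Qed.

Lemma ltn_size_filter_neq (s : seq 'X_{1..n}) u : u \in s ->
  (size (filter (predC1 u) s) + \sum_(a <- filter (predC1 u) s) mdeg a <
    size s + \sum_(a <- s) mdeg a)%N.
Proof.
move=> us; rewrite -addSn leq_add //.
  by rewrite size_filter -(count_predC (pred1 u) s) -add1n leq_add2r -has_count has_pred1.
by rewrite big_filter [X in (_ <= X)%N](bigID (pred1 u)) /= leq_addl.
Qed.

Lemma mdeg_lt g u : (g <= u)%MM -> g != u -> (mdeg g < mdeg u)%N.
Proof.
move=> gu neq; rewrite -(submK gu) mdegD -[X in (X < _)%N]add0n ltn_add2r lt0n mdeg_eq0.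
by apply: contraNneq neq => ug0; rewrite -(submK gu) ug0 add0m.
Qed.

(** The induction is on the number of elements of [s] plus their total degree: splitting lowers the
    degree, while dropping a generator or moving one to [V] lowers the number. *)
Theorem forest_mfilt (s : seq 'X_{1..n}) (V : {set 'I_n}) : forest s ->
    (forall a k, a \in s -> k \in V -> a k = 0%N) ->
  forall d, let I := upset (forest_gens s V) in
    mfilt d (dim_below I d) (dim_below I d.+1).
Proof.
move: {2}(size s + _)%N.+1 (leqnn (size s + \sum_(a <- s) mdeg a).+1) => N.
elim: N s V => // N IHN s V; rewrite ltnS => leN fs sV d /=.
have [s0|s0] := eqVneq s [::].
  rewrite (_ : upset _ = [set m | outside (~: V) m]); first exact: mfilt_prime.
  apply/seteqP; split=> [m [a [|[k kV ->]]]|m /outsideP[k]].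
  - by rewrite s0.
  - by rewrite lep1mP -lt0n => mk; apply/outsideP; exists k; rewrite // inE negbK.
  - rewrite inE negbK => kV mk; exists U_(k)%MM; first by right; exists k.
    by rewrite lep1mP -lt0n.
have [//|u us leaf_u] := fs s s0.
have uV k : k \in V -> u k = 0%N by apply: sV.
have gens_u : forest_gens s V u by left.
have [u0|u0] := eqVneq u 0%MM.
  have DT e : dim_below (upset (forest_gens s V)) e = setT.
    apply/seteqP; split=> // m _; apply: sub_dim_below; exists u => //.
    by rewrite u0; apply/mnm_lepP => i; rewrite mnm0E.
  by rewrite !DT; apply: mfilt0.
have split_at g : g != 0%MM -> (g <= u)%MM -> g != u ->
    (forall w, w \in s -> w != u -> (mgcd u w <= g)%MM) ->
    mfilt d (dim_below (upset (forest_gens s V)) d)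
            (dim_below (upset (forest_gens s V)) d.+1).
  move=> g0 gu neq_gu gcd_u.
  have gV k : k \in V -> g k = 0%N.
    by move=> /uV uk; have /mnm_lepP/(_ k) := gu; rewrite uk leqn0 => /eqP.
  apply: (mfilt_split gens_u gu) => [a|e|e].
  - case=> [as_|[k kV ->]]; first exact: gcd_u.
    move=> _; apply/mnm_lepP => i; rewrite mnmE mnm1E.
    by case: eqP => [<-|_] /=; [rewrite uV // min0n|rewrite minn0].
  (* Subtraction of multinomials is truncated, so [a - g] is [a / gcd (a, g)], the generator of the
     colon coming from [a]. *)
  - set I' := [set m | _].
    have -> : I' = upset (forest_gens (map (fun a => a - g)%MM s) V).
      apply/seteqP; split=> [m [a ga agm]|m [a ga agm]].
        case: ga => [as_|[k kV a_eq]].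
          exists (a - g)%MM; first by left; apply: (map_f (fun a => a - g)%MM).
          apply/mnm_lepP => i; rewrite mnmBE leq_subLR.
          by move/mnm_lepP/(_ i): agm; rewrite mnmDE.
        exists a; first by right; exists k.
        by move: agm; rewrite a_eq !lep1mP mnmDE gV.
      case: ga agm => [/mapP[b bs ->]|[k kV a_eq]] agm.
        exists b; first by left.
        apply/mnm_lepP => i; rewrite mnmDE -leq_subLR -mnmBE.
        exact/mnm_lepP.
      exists a; first by right; exists k.
      by move: agm; rewrite a_eq !lep1mP mnmDE gV.
    apply: IHN; last 1 first.
    + by move=> _ k /mapP[b bs ->] kV; rewrite mnmBE (sV b).
    + apply: leq_trans leN; rewrite size_map big_map ltn_add2l.
      apply: (ltn_sum_seq (u := u)) => // [a _|]; first exact: mdegB.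
      by rewrite -[X in (_ < mdeg X)%N](submK gu) mdegD -addn1 leq_add2l lt0n mdeg_eq0.
    + apply: forest_map fs _ => a b c _ _ _ _ _ abc.
      apply/mnm_lepP => i; rewrite mnmE !mnmBE -subn_minl leq_sub2r //.
      by move/mnm_lepP/(_ i): abc; rewrite mnmE.
  (* Since [g] divides [u], adding [g] amounts to replacing [u] by [g]. *)
  - pose f a := if a == u then g else a.
    have -> : upset (forest_gens s V) `|` [>= g] = upset (forest_gens (map f s) V).
      apply/seteqP; split=> m.
        case=> [[a [as_|ga] am]|gm].
        - exists (f a); first by left; apply: map_f.
          by rewrite /f; case: eqP => // a_eq; apply: lepm_trans gu _; rewrite -a_eq.
        - by exists a => //; right.
        - by exists (f u); [left; apply: map_f|rewrite /f eqxx].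
      case=> a [/mapP[b bs ->]|ga] am; last by left; exists a => //; right.
      by move: am; rewrite /f; case: eqP => _ am; [right|left; exists b => //; left].
    apply: IHN; last 1 first.
    + move=> _ k /mapP[b bs ->] kV; rewrite /f.
      by case: eqP => _; [apply: gV|apply: sV].
    + apply: leq_trans leN; rewrite size_map big_map ltn_add2l.
      apply: (ltn_sum_seq (u := u)) => // [a _|]; rewrite /f ?eqxx ?mdeg_lt //.
      by case: eqP => [->|//]; apply/ltnW/mdeg_lt.
    + apply: forest_map fs _ => a b c as_ bs cs ab ac /mnm_lepP abc.
      apply/mnm_lepP => i; have := abc i; rewrite !mnmE /f.
      (* The delicate case is [c = u]: then [gcd (a, b)] divides [gcd (u, a)], hence [g]. *)
      have [au|au] := eqVneq a u; have [bu|bu] := eqVneq b u;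
        have [cu|cu] := eqVneq c u.
      * by rewrite au bu eqxx in ab.
      * by rewrite au bu eqxx in ab.
      * by rewrite au cu eqxx in ac.
      * by move/mnm_lepP/(_ i): gu; rewrite au; clear; lia.
      * by rewrite geq_minr.
      * by move/mnm_lepP/(_ i): gu; rewrite bu; clear; lia.
      * by have /mnm_lepP/(_ i) := gcd_u a as_ au; rewrite mnmE cu; clear; lia.
      * by [].
have isolated : (forall w, w \in s -> w != u -> mgcd u w = 0%MM) ->
    mfilt d (dim_below (upset (forest_gens s V)) d)
            (dim_below (upset (forest_gens s V)) d.+1).
  move=> gcd_u.
  have [y uy] : exists y, (0 < u y)%N.
    apply: contrapT => /forallNP u_eq0; case/eqP: u0; apply/mnmP => i.
    by rewrite mnm0E; apply/eqP; rewrite -leqn0 leqNgt; apply/negP.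
  have yu : (U_(y) <= u)%MM by rewrite lep1mP -lt0n.
  (* If [u] is not the variable [y], split at [y]; if it is, no other element of [s] involves [y],
     and [u] moves to [V]. *)
  have [u_eq|neq_yu] := eqVneq U_(y)%MM u; last first.
    apply: (split_at U_(y)%MM) => //; first by rewrite mnm1_eq0.
    by move=> w ws wu; rewrite gcd_u //; apply/mnm_lepP => i; rewrite mnm0E.
  have -> : upset (forest_gens s V) =
            upset (forest_gens (filter (predC1 u) s) (y |: V)).
    apply/seteqP; split=> m [a ga am].
      exists a => //; case: ga => [as_|[k kV ->]]; last by right; exists k; rewrite // inE kV orbT.
      have [->|au] := eqVneq a u; last by left; rewrite mem_filter /= au.
      by right; exists y; rewrite ?u_eq // !inE eqxx.
    exists a => //; case: ga => [|[k]]; first by rewrite mem_filter => /andP[_ ?]; left.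
    rewrite !inE => /orP[/eqP-> ->|kV ->]; first by left; rewrite u_eq.
    by right; exists k.
  apply: IHN.
  - exact: leq_trans (ltn_size_filter_neq us) leN.
  - by apply: forest_subset fs _ => a; rewrite mem_filter => /andP[].
  - move=> a k; rewrite mem_filter /= => /andP[au as_]; rewrite !inE => /orP[/eqP->|]; last exact: sV.
    by have /mnmP/(_ y) := gcd_u a as_ au; rewrite mnmE mnm0E; move: uy; clear; lia.
case: leaf_u => [all_u|[v [vs vu leaf_u]]].
  by apply: isolated => w /all_u ->; rewrite eqxx.
(* The generators in [s] need not be minimal: if [u] divides [v], then [v] is redundant and is
   dropped. Otherwise [gcd (u, v)] is a proper divisor of [u]. *)
have [uv|uv] := boolP (u <= v)%MM.
  have -> : upset (forest_gens s V) = upset (forest_gens (filter (predC1 v) s) V).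
    apply/seteqP; split=> m [a ga am].
      case: ga => [as_|ga]; last by exists a => //; right.
      have [a_eq|av] := eqVneq a v; last by exists a => //; left; rewrite mem_filter /= av.
      exists u; first by left; rewrite mem_filter /= eq_sym vu.
      by apply: lepm_trans uv _; rewrite -a_eq.
    exists a => //; case: ga => [|ga]; last by right.
    by rewrite mem_filter => /andP[_ ?]; left.
  apply: IHN.
  - exact: leq_trans (ltn_size_filter_neq vs) leN.
  - by apply: forest_subset fs _ => a; rewrite mem_filter => /andP[].
  - by move=> a k; rewrite mem_filter => /andP[_]; apply: sV.
have leaf_u' w : w \in s -> w != u -> (mgcd u w <= mgcd u v)%MM.
  move=> ws wu; have /mnm_lepP uwv := leaf_u w ws wu.
  by apply/mnm_lepP => i; have := uwv i; rewrite !mnmE; clear; lia.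
have [guv|guv] := eqVneq (mgcd u v) 0%MM.
  apply: isolated => w ws wu; apply/mnmP => i.
  by have /mnm_lepP/(_ i) := leaf_u' w ws wu; rewrite guv mnm0E; clear; lia.
apply: (split_at (mgcd u v)) => //.
  by apply/mnm_lepP => i; rewrite mnmE geq_minl.
apply: contraNneq uv => <-; by apply/mnm_lepP => i; rewrite mnmE geq_minr.
Qed.

End MonomialFiltrations.

(** * Monomial ideals *)

Section MonomialIdeals.
Variables (K : fieldType) (n : nat).
Local Notation S := {mpoly K[n]}.
Implicit Types (U N E : set 'X_{1..n}) (J : set S) (p q : S).
Implicit Types (m w t : 'X_{1..n}) (Z : {set 'I_n}).

(** The span over [K] of the monomials in [U]; it is an ideal once [U] is closed under multiples. *)
Definition mideal U : set S := [set p | forall m, m \in msupp p -> U m].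

Definition upclosed U := forall m w, U m -> U (m + w)%MM.

Lemma upclosed_upset E : upclosed (upset E).
Proof. by move=> m w [a Ea am]; exists a => //; apply: lepm_trans am (lem_addr _ _). Qed.

Lemma upclosed_dim_below U d : upclosed U -> upclosed (dim_below U d).
Proof.
move=> upU m w Dm Z indepZ; apply: Dm => s Ums; apply: indepZ.
by rewrite -addmA (addmC w) addmA; apply: upU.
Qed.

Lemma mideal_submodule U : upclosed U -> submodule setT (mideal U).
Proof.
move=> upU; split.
- by move=> m; rewrite msupp0.
- move=> p q Up Uq m /msuppD_le; rewrite mem_cat => /orP[/Up|/Uq] //.
- move=> a p _ Up m /msuppM_le /allpairsP[[m1 m2] /= [_ /Up Um2 ->]].
  by rewrite addmC; apply: upU.
Qed.

Lemma mideal_min U J : submodule setT J -> (forall m, U m -> J 'X_[m]) ->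
  mideal U `<=` J.
Proof.
move=> sJ UJ p Up; rewrite (mpolyE p) big_seq.
apply: (submodule_sum sJ) => m /Up /UJ; rewrite -mul_mpolyC.
by case: sJ => _ _; apply.
Qed.

Lemma midealX U m : mideal U 'X_[m] <-> U m.
Proof.
split=> [|Um w]; last by rewrite msuppX inE => /eqP ->.
by apply; rewrite msuppX inE eqxx.
Qed.

Lemma midealMX U t p :
  mideal U ('X_[t] * p) <-> mideal [set w | U (t + w)%MM] p.
Proof.
have supp m : (t + m)%MM \in msupp ('X_[t] * p) = (m \in msupp p).
  by rewrite mulrC (perm_mem (msuppMX p t)) mem_map //; apply: addmI.
split=> Up m; first by rewrite -supp; apply: Up.
rewrite mulrC (perm_mem (msuppMX p t)) => /mapP[w wp ->]; exact: Up.
Qed.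

Lemma midealT : mideal setT = setT. Proof. by apply/seteqP; split. Qed.

Lemma mideal_mono U N : U `<=` N -> mideal U `<=` mideal N.
Proof. by move=> UN p Up m /Up/UN. Qed.

Lemma mideal_add N t : upclosed N ->
  mideal (N `|` [set m | (t <= m)%MM]) = add_mul setT (mideal N) 'X_[t].
Proof.
move=> upN; have sN := mideal_submodule upN.
have sT := subring_submodule (subring_setT S).
apply/seteqP; split.
  apply: mideal_min; first exact: add_mul_submodule.
  move=> m [Nm|/lem_addE[r ->]].
    by apply: (@sub_add_mul _ setT) => //; apply/midealX.
  exists 0, 'X_[r]; split=> //; last by rewrite add0r mpolyXD.
  by case: sN.
move=> _ [p [q [Np _ ->]]] m /msuppD_le; rewrite mem_cat => /orP[/Np|]; first by left.
by rewrite mulrC (perm_mem (msuppMX q t)) => /mapP[w _ ->]; right; apply: lem_addr.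
Qed.

Lemma ideal_gen_submodule (E : set S) : submodule setT (ideal_gen E).
Proof.
split.
- by move=> N [[N0 _ _] _].
- by move=> x y Ex Ey N NE; have [[_ ND _] _] := NE; apply: ND; [apply: Ex|apply: Ey].
- by move=> a x _ Ex N NE; have [[_ _ NM] _] := NE; apply: NM => //; apply: Ex.
Qed.

Lemma monomial_genE E : @monomial_gen n K E = mideal (upset E).
Proof.
apply/seteqP; split.
  apply: smallest_sub; first exact: mideal_submodule (@upclosed_upset E).
  by move=> _ [m Em <-]; apply/midealX; exists m => //; apply: lepm_refl.
apply: mideal_min; first exact: ideal_gen_submodule.
move=> m [a Ea /lem_addE[r ->]]; rewrite mpolyXD mulrC.
have [_ _ EM] := ideal_gen_submodule [set ('X_[m] : S) | m in E].
apply: EM => //; apply: sub_gen_smallest; by exists a.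
Qed.

End MonomialIdeals.

(** * Polynomials in one of the variables *)

Section OneVariable.
Variables (K : fieldType) (n : nat).
Local Notation S := {mpoly K[n]}.
Implicit Types (p q : S) (k : 'I_n).

Definition in_var k (f : {poly K}) : S := (map_poly (@mpolyC n K) f).['X_k].

(** Views a polynomial as one in ['X_k] whose coefficients involve only the other variables; these
    coefficients are kept in the same ring [S]. *)
Definition split_var k : S -> {poly S} :=
  mmap (@polyC _ \o @mpolyC n K) (fun j => if j == k then 'X else ('X_j)%:P).

HB.instance Definition _ k := GRing.RMorphism.on (split_var k).

Lemma split_varC k c : split_var k c%:MP = (c%:MP)%:P.
Proof. exact: mmapC. Qed.

Lemma split_varX k j : split_var k 'X_j = if j == k then 'X else ('X_j)%:P.
Proof. by rewrite /split_var mmapX mmap1U. Qed.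

Lemma split_var_in_var k j f :
  split_var k (in_var j f) = if j == k then map_poly (@mpolyC n K) f else (in_var j f)%:P.
Proof.
rewrite /in_var -horner_map /= split_varX -map_poly_comp.
rewrite (eq_map_poly (g := @polyC _ \o @mpolyC n K)); last exact: split_varC.
rewrite map_poly_comp; case: eqP => _; first exact: comp_polyXr.
by rewrite horner_map.
Qed.

Lemma split_varK k p : (split_var k p).['X_k] = p.
Proof.
rewrite [in RHS](mpolyE p) /split_var /mmap horner_sum; apply: eq_bigr => m _.
rewrite hornerM /= hornerC mul_mpolyC; congr (_ *: _).
rewrite /mmap1 horner_prod [RHS]mpolyXE_id; apply: eq_bigr => i _.
by rewrite horner_exp; case: eqP => [->|_]; rewrite ?hornerX ?hornerC.
Qed.

(** Descending induction on [i]: in the coefficient of [f * q] of index [(size f).-1 + i], the unit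
    [lead_coef f] multiplies the coefficient of [q] of index [i], and the other terms involve only
    later coefficients of [q]. *)
Lemma coef_mul_unit_lead (R : comNzRingType) (J : set R) (f q : {poly R}) (u : R) :
    submodule setT J -> u * lead_coef f = 1 ->
  (forall i, J (f * q)`_i) -> forall i, J q`_i.
Proof.
move=> sJ uf Jfq i; have [J0 JD JM] := sJ.
move: {2}(size q - i)%N (leqnn (size q - i)) => k.
elim: k i => [|k IHk] i; first by rewrite leqn0 subn_eq0 => /leq_sizeP->.
move=> lek; have := Jfq ((size f).-1 + i)%N; rewrite coefM.
have lt_f : ((size f).-1 < ((size f).-1 + i).+1)%N by rewrite ltnS leq_addr.
rewrite (bigD1 (Ordinal lt_f)) //= -lead_coefE addKn => Jsum.
have -> : q`_i = u * (lead_coef f * q`_i) by rewrite mulrA uf mul1r.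
apply: (JM) => //; rewrite -[X in J X](addrK (\sum_(j < ((size f).-1 + i).+1 | j != Ordinal lt_f)
  f`_j * q`_((size f).-1 + i - j))).
apply: (submoduleB (subring_setT R) sJ Jsum).
apply: (submodule_sum sJ) => j jf; have [lt_jf|le_fj] := ltnP j (size f).-1.
  apply: (JM) => //; have [le_q|lt_q] := leqP (size q) i.
    by rewrite nth_default //; apply: leq_trans le_q _; rewrite -addnBAC ?leq_addl // ltnW.
  have arith (a b c e : nat) : (e < a -> c < b -> b - c <= k.+1 -> b - (a + c - e) <= k)%N.
    by clear; lia.
  by apply: IHk; apply: arith.
rewrite nth_default ?mul0r //; apply: leq_trans (leqSpred _) _.
by rewrite ltn_neqAle le_fj andbT eq_sym.
Qed.

(** The generators of the ideal are free of ['X_k], so membership can be tested on coefficients in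
    ['X_k], where [f k] has an invertible leading coefficient. *)
Lemma in_var_nzd (f : 'I_n -> {poly K}) (W : {set 'I_n}) k : f k != 0 -> k \in W ->
  nonzerodivisor_on setT (compl_ideal (fun j => in_var j (f j)) W) (in_var k (f k)).
Proof.
move=> fk0 kW p _; set J := compl_ideal _ W.
have sJ : submodule setT J := compl_ideal_submodule _ W; have [J0 JD JM] := sJ.
have splitJ q : J q -> forall i, J (split_var k q)`_i.
  move=> [a ->] i; rewrite rmorph_sum coef_sum; apply: (submodule_sum sJ) => j jW.
  rewrite rmorphM /= split_var_in_var; case: eqP => [jk|_]; first by rewrite jk kW in jW.
  by rewrite coefMC; apply: (JM) => //; apply: compl_ideal_gen.
move=> /splitJ; rewrite rmorphM /= split_var_in_var eqxx => Jfp.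
have Jp : forall i, J (split_var k p)`_i.
  apply: (coef_mul_unit_lead (u := ((lead_coef (f k))^-1)%:MP) sJ _ Jfp).
  by rewrite lead_coef_map -mpolyCM mulVf ?mpolyC1 // lead_coef_eq0.
rewrite -(split_varK k p) horner_coef; apply: (submodule_sum sJ) => i _.
by rewrite mulrC; apply: JM.
Qed.

End OneVariable.

(** * Dimension of polynomial rings *)

Section PrimeChainBound.
Variables (K : fieldType) (n : nat).
Local Notation S := {mpoly K[n]}.
Implicit Types (p q y : S) (ys : seq S) (Z : {set 'I_n}) (c : seq nat -> K).

(** A polynomial in the elements [ys] with all exponents below [N], where [c] maps exponent
    sequences to coefficients. The nesting exposes the powers of the first element. *)
Fixpoint poly_in (N : nat) ys c : S :=
  if ys is y :: ys' then \sum_(a < N) y ^+ a * poly_in N ys' (fun al => c (nat_of_ord a :: al))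
  else (c [::])%:MP.

Lemma poly_in_linear N ys a c1 c2 :
  poly_in N ys (fun al => a * c1 al + c2 al) = a *: poly_in N ys c1 + poly_in N ys c2.
Proof.
elim: ys c1 c2 => [|y ys IHys] c1 c2 /=; first by rewrite mpolyCD mpolyCM mul_mpolyC.
rewrite scaler_sumr -big_split; apply: eq_bigr => i _ /=.
by rewrite IHys mulrDr -scalerAr.
Qed.

Lemma poly_in_eq0 N ys c :
  (forall al, size al = size ys -> all (fun a => a < N)%N al -> c al = 0) ->
  poly_in N ys c = 0.
Proof.
elim: ys c => [|y ys IHys] c c0 /=; first by rewrite c0.
rewrite big1 // => a _; rewrite IHys ?mulr0 // => al size_al all_al.
by apply: c0; rewrite /= ?size_al ?ltn_ord.
Qed.

Definition mdeg_le (D : nat) p := forall m, m \in msupp p -> (mdeg m <= D)%N.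

Lemma mdeg_leM D E p q : mdeg_le D p -> mdeg_le E q -> mdeg_le (D + E) (p * q).
Proof.
move=> Dp Eq m /msuppM_le /allpairsP[[m1 m2] /= [/Dp le1 /Eq le2 ->]].
by rewrite mdegD leq_add.
Qed.

Lemma mdeg_leX D p k : mdeg_le D p -> mdeg_le (k * D) (p ^+ k).
Proof.
move=> Dp; elim: k => [|k IHk]; last by rewrite exprS mulSn; apply: mdeg_leM.
by move=> m; rewrite expr0 msupp1 inE => /eqP ->; rewrite mdeg0.
Qed.

Lemma mdeg_le_sum D (I : Type) (r : seq I) (f : I -> S) :
  (forall i, mdeg_le D (f i)) -> mdeg_le D (\sum_(i <- r) f i).
Proof.
move=> Df; elim/big_rec: _ => [m|i p _ Dp m]; first by rewrite msupp0.
by move/msuppD_le; rewrite mem_cat => /orP[/Df|/Dp].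
Qed.

Lemma mdeg_poly_in N D ys c : (forall y, y \in ys -> mdeg_le D y) ->
  mdeg_le (size ys * (N * D)) (poly_in N ys c).
Proof.
elim: ys c => [|y ys IHys] c Dys /=.
  by move=> m; rewrite msuppC; case: eqP => // _; rewrite inE => /eqP ->; rewrite mdeg0.
apply: mdeg_le_sum => a; rewrite mulSn; apply: mdeg_leM; last first.
  by apply: IHys => z zys; apply: Dys; rewrite inE zys orbT.
move=> m /(mdeg_leX (Dys y (mem_head _ _))) /leq_trans; apply.
by rewrite leq_mul2r ltnW ?ltn_ord ?orbT.
Qed.

Lemma exists_lin_relation (I J : finType) (f : I -> J -> K) : (#|J| < #|I|)%N ->
  exists2 v : I -> K, (exists i, v i != 0) & forall j, \sum_i v i * f i j = 0.
Proof.
move=> ltJI; pose A := \matrix_(i < #|I|, j < #|J|) f (enum_val i) (enum_val j).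
have : kermx A != 0.
  by rewrite -mxrank_eq0 mxrank_ker subn_eq0 -ltnNge (leq_ltn_trans (rank_leq_col A)).
case/rowV0Pn => v /sub_kermxP vA v0; exists (fun i => v 0 (enum_rank i)).
  have /existsP[i vi] : [exists i, v 0 i != 0].
    apply: contraNT v0; rewrite negb_exists => /forallP v0; apply/eqP/rowP => i.
    by rewrite mxE; apply/eqP/negbNE.
  by exists (enum_val i); rewrite enum_valK.
move=> j; move/rowP/(_ (enum_rank j)): vA; rewrite !mxE; apply: etrans.
rewrite (reindex (@enum_val _ I)) /=; last first.
  by exists enum_rank => i _; rewrite ?enum_valK ?enum_rankK.
by apply: eq_bigr => i _; rewrite enum_valK mxE enum_rankK.
Qed.

Definition coef_at (T : finType) (e : T -> seq nat) (t : T) al : K := (al == e t)%:R.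

Lemma poly_in_sum N ys (T : finType) (v : T -> K) (c : T -> seq nat -> K) :
  poly_in N ys (fun al => \sum_t v t * c t al) = \sum_t v t *: poly_in N ys (c t).
Proof.
elim: index_enum => [|t s IHs].
  rewrite big_nil; apply: poly_in_eq0 => al _ _; exact: big_nil.
rewrite big_cons -IHs -poly_in_linear; congr poly_in.
by apply: functional_extensionality_dep => al; rewrite big_cons.
Qed.

(* Counting: the [N ^ (d + 1)] monomials in [d + 1] elements with exponents
   smaller than [N] have degree [O(N)], hence span modulo the variables outside
   [Z] a space of dimension [O(N ^ d)], where [d = #|Z|]. *)
Lemma poly_in_dependent Z ys : size ys = #|Z|.+1 ->
  exists N c al, [/\ size al = size ys, all (fun a => a < N)%N al, c al != 0
                   & mideal [set m | outside Z m] (poly_in N ys c)].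
Proof.
move=> size_ys; set e := size ys; pose D := (\sum_(y <- ys) msize y)%N.
have Dys y : y \in ys -> mdeg_le D y.
  move=> yys m my; apply: leq_trans (ltnW (msize_mdeg_lt my)) _.
  by rewrite /D (big_rem y yys) /= leq_addr.
(* With [d = #|Z|], more than [(B + 1) ^ d] products are needed. As [B + 1 <= N * (e * D + 1)], it
   suffices that [N] exceed [(e * D + 1) ^ d]. *)
pose N := ((e * D).+1 ^ #|Z|).+1; pose B := (e * (N * D))%N.
pose J := {ffun {k : 'I_n | k \in Z} -> 'I_B.+1}.
pose mon (u : J) : 'X_{1..n} := [multinom if insub k is Some k' then nat_of_ord (u k') else 0%N | k < n].
pose ex (t : e.-tuple 'I_N) := map val t.
pose p t := poly_in N ys (coef_at ex t).
have [|v [t vt] rel] := @exists_lin_relation _ J (fun t u => (p t)@_(mon u)).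
  rewrite card_ffun card_tuple !card_ord card_sig.
  rewrite (eq_card (B := mem Z)); last by move=> k; rewrite !inE.
  rewrite /e size_ys; apply: (@leq_ltn_trans ((N * (e * D).+1) ^ #|Z|)%N).
    have leX a b k : (a <= b -> a ^ k <= b ^ k)%N by case: k => // k; rewrite leq_exp2r.
    by apply: leX; rewrite /B mulnCA mulnS -add1n leq_add2r.
  by rewrite expnMn expnSr ltn_pmul2l ?expn_gt0 // /N ltnS.
pose c al := \sum_t v t * coef_at ex t al.
exists N, c, (ex t); split.
- by rewrite size_map size_tuple.
- by apply/allP => _ /mapP[i _ ->]; apply: ltn_ord.
- rewrite /c (bigD1 t) //= /coef_at eqxx mulr1 big1 ?addr0 // => t' t't.
  rewrite (_ : (_ == _) = false) ?mulr0 //; apply: contraNF t't => /eqP /(inj_map val_inj) tt'.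
  by apply/eqP/val_inj.
(* A monomial in the variables of [Z] alone has coefficient zero: by the degree bound if its degree
   exceeds [B], by the linear relation otherwise. *)
move=> m; rewrite mcoeff_msupp; apply: contraNT => mZ; apply/eqP.
have [Bm|Bm] := leqP (mdeg m) B; last first.
  by apply: memN_msupp_eq0; apply: contraTN Bm => /(mdeg_poly_in Dys); rewrite -leqNgt.
pose u : J := [ffun k => inord (m (val k))].
have -> : m = mon u.
  apply/mnmP => k; rewrite mnmE; case: insubP => [k' _ <-|kZ].
    rewrite ffunE inordK // ltnS; apply: leq_trans Bm.
    by rewrite mdegE (bigD1 (val k')) //= leq_addr.
  by apply/eqP; rewrite -leqn0 leqNgt; apply: contra mZ => mk; apply/outsideP; exists k.
rewrite /c poly_in_sum raddf_sum /= -[RHS](rel u); apply: eq_bigr => t' _.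
by rewrite mcoeffZ.
Qed.

(* In a relation [\sum_a y_0 ^ a R_a] lying in [Q 0], the lowest coefficient
   [R_a] lies in [Q 1], and is a relation between the remaining elements. *)
Lemma poly_in_independent N ys (Q : nat -> set S) c :
    (forall i, (i <= size ys)%N -> prime_ideal setT (Q i)) ->
    (forall i, (i < size ys)%N ->
       [/\ Q i `<=` Q i.+1, Q i.+1 (nth 0 ys i) & ~ Q i (nth 0 ys i)]) ->
    Q 0%N (poly_in N ys c) ->
  forall al, size al = size ys -> all (fun a => a < N)%N al -> c al = 0.
Proof.
elim: ys Q c => [|y ys IHys] Q c primeQ ltQ /=.
  move=> Q0 [|//] _ _; apply: contrapT => /eqP c0.
  have [_ [_ _ QM] Q1 _] := primeQ 0%N isT; apply: Q1.
  have -> : 1 = (c [::])^-1%:MP * (c [::])%:MP :> S by rewrite -mpolyCM mulVf ?mpolyC1.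
  exact: QM.
move=> Q0 [//|a al] /= [size_al] /andP[ltaN all_al].
have [Q01 Q1y Q0y] := ltQ 0%N isT.
have [_ sQ0 _ Q0prime] := primeQ 0%N isT; have [_ sQ1 _ _] := primeQ 1%N isT.
pose R b := poly_in N ys (fun be => c (b :: be)).
(* By strong induction all coefficients below [a] vanish, so [y ^+ a] factors out of the relation;
   it is not in the prime [Q 0]. *)
elim/ltn_ind: a ltaN al size_al all_al => a IHa ltaN al size_al all_al.
have R0 b : (b < a)%N -> R b = 0.
  by move=> ltba; apply: poly_in_eq0 => be ? ?; apply: IHa => //; apply: ltn_trans ltaN.
pose T := \sum_(b < N | (a < b)%N) y ^+ (b - a.+1) * R b.
have sumE : \sum_(b < N) y ^+ b * R b = y ^+ a * (R a + y * T).
  rewrite (bigD1 (Ordinal ltaN)) //= mulrDr; congr (_ + _).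
  rewrite (bigID (fun b : 'I_N => (a < b)%N)) /= addrC big1 ?add0r; last first.
    by move=> b /andP[ba]; rewrite -leqNgt leq_eqVlt (negPf (ba : (b : nat) != a)) => /R0 ->; rewrite mulr0.
  rewrite !mulr_sumr; apply: eq_big => [b|b /andP[_ ltab]].
    by rewrite andbC; case: ltngtP => //= ltab; rewrite -val_eqE /= gtn_eqF.
  by rewrite !mulrA -exprSr -exprD subnKC.
have Q0X k : ~ Q 0%N (y ^+ k).
  elim: k => [|k IHk]; first by rewrite expr0; case: (primeQ 0%N isT).
  by rewrite exprS => /(Q0prime _ _ I I)[].
move: Q0; rewrite [X in Q 0%N X]sumE => /(Q0prime _ _ I I)[/Q0X//|/Q01 Q1R].
have {Q1R} : Q 1%N (R a).
  rewrite -[R a](addrK (y * T)); apply: (submoduleB (subring_setT _) sQ1) => //.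
  by rewrite mulrC; case: sQ1 => _ _; apply.
move=> Q1R; apply: (IHys (fun i => Q i.+1) _ _ _ Q1R) => // i lti.
- exact: (primeQ i.+1).
- exact: (ltQ i.+1).
Qed.

(** In a longer chain, choose an element of each [Q i.+1] outside [Q i]. The dependence of [#|Z|.+1]
    of them modulo the variables outside [Z] contradicts [poly_in_independent]. *)
Lemma prime_chain_bound Z e (Q : nat -> set S) :
    (forall i, (i <= e)%N -> prime_ideal setT (Q i)) ->
    (forall i, (i < e)%N -> Q i `<` Q i.+1) ->
  mideal [set m | outside Z m] `<=` Q 0%N -> (e <= #|Z|)%N.
Proof.
move=> primeQ ltQ ZQ; rewrite leqNgt; apply/negP => ltZe.
have /choice[f fP] i : exists p, (i < e)%N -> Q i.+1 p /\ ~ Q i p.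
  have [ltie|_] := boolP (i < e)%N; last by exists 0.
  have [_ /existsNP[p /not_implyP[Qp nQp]]] := ltQ i ltie.
  by exists p.
pose ys := mkseq f #|Z|.+1; have size_ys : size ys = #|Z|.+1 by rewrite size_mkseq.
have [N [c [al [size_al all_al cal0 /ZQ Qc]]]] := poly_in_dependent size_ys.
case/eqP: cal0; apply: (poly_in_independent _ _ Qc size_al all_al) => i.
  by rewrite size_ys => lei; apply: primeQ; apply: leq_trans ltZe.
rewrite size_ys => lti; have ltie : (i < e)%N := leq_trans lti ltZe.
by rewrite nth_mkseq //; have [Qf nQf] := fP i ltie; have [subQ _] := ltQ i ltie.
Qed.

End PrimeChainBound.

(** * The Nullstellensatz *)

Lemma exists_quotient (R : comNzRingType) (m : set R) : submodule setT m -> ~ m 1 ->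
  exists (B : comNzRingType) (pi : {rmorphism R -> B}), forall x, pi x = 0 <-> m x.
Proof.
move=> [m0 mD mM] m1; pose P : R -> bool := fun x => `[< m x >].
have closedP : idealr_closed P.
  split; [exact/asboolP|exact/asboolP|move=> a u v /asboolP mu /asboolP mv].
  by apply/asboolP; apply: (mD) => //; apply: mM.
pose I : idealr R := HB.pack P (isIdealr.Build R P closedP).
pose B : comNzRingType := {ideal_quot I}.
pose pi0 (x : R) : B := (\pi_({ideal_quot I}) x)%qT.
have piB : zmod_morphism pi0 by move=> x y; rewrite /pi0 !piE.
have piM : monoid_morphism pi0 by split=> [|x y]; rewrite /pi0 !piE.
pose pi1 := GRing.isZmodMorphism.Build _ _ pi0 piB.
pose pi2 := GRing.isMonoidMorphism.Build _ _ pi0 piM.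
pose pi : {rmorphism R -> B} := HB.pack pi0 pi1 pi2.
exists B, pi => x; rewrite /= /pi0; split.
  by move/eqP; rewrite piE Quotient.equivE subr0 => /asboolP.
by move=> mx; apply/eqP; rewrite piE Quotient.equivE subr0; apply/asboolP.
Qed.


Lemma exp_sub1 (R : comNzRingType) (p : R) L :
  exists w, (p - 1) ^+ L = (-1) ^+ L + p * w.
Proof.
elim: L => [|L [w IHL]]; first by exists 0; rewrite mulr0 addr0.
by exists ((-1) ^+ L + (p - 1) * w); rewrite !exprS IHL; ring.
Qed.

Lemma maximal_ideal_inv (R : comNzRingType) (m : set R) x : maximal_ideal m -> ~ m x ->
  exists y, m (x * y - 1).
Proof.
move=> [sm m1 max_m] mx; apply: contrapT => /forallNP noinv; apply: mx.
have sT := subring_submodule (subring_setT R).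
apply: (max_m (add_mul setT m x)); first exact: add_mul_submodule.
- exact: (@sub_add_mul _ setT).
- move=> [z [y [mz _ e1]]]; apply: (noinv y).
  have -> : x * y - 1 = - z by rewrite e1; ring.
  exact: (submoduleN (subring_setT R)).
- by exists 0, 1; split; rewrite ?mulr1 ?add0r //; case: sm.
Qed.

Section Nullstellensatz.
Variables (K : fieldType) (n : nat).
Local Notation S := {mpoly K[n]}.
Implicit Types (p q : S) (Z : {set 'I_n}) (j k : 'I_n).

Lemma mpoly_rmorph_ext (R : comNzRingType) (f g : {rmorphism S -> R}) :
  (forall c, f c%:MP = g c%:MP) -> (forall j, f 'X_j = g 'X_j) -> f =1 g.
Proof.
move=> fgC fgX p; rewrite (mpolyE p) !raddf_sum; apply: eq_bigr => m _ /=.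
rewrite -mul_mpolyC !rmorphM fgC mpolyXE_id !rmorph_prod; congr (_ * _).
by apply: eq_bigr => j _; rewrite !rmorphXn fgX.
Qed.

(** Sets the variables outside [Z] to zero, so that [restrict Z p = p] expresses that [p] lies in
    [K[Z]]. *)
Definition restrict Z : S -> S :=
  mmap (@mpolyC n K) (fun j => if j \in Z then 'X_j else 0).

HB.instance Definition _ Z := GRing.RMorphism.on (restrict Z).

Lemma restrictC Z c : restrict Z c%:MP = c%:MP. Proof. exact: mmapC. Qed.

Lemma restrictX Z j : restrict Z 'X_j = if j \in Z then 'X_j else 0.
Proof. by rewrite /restrict mmapX mmap1U. Qed.

Lemma restrict_id Z p : restrict Z (restrict Z p) = restrict Z p.
Proof.
apply: (mpoly_rmorph_ext (f := restrict Z \o restrict Z) (g := restrict Z)) => /= [c|j].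
  by rewrite !restrictC.
by rewrite !restrictX; case: ifP => jZ; rewrite ?restrictX ?jZ ?rmorph0.
Qed.

Lemma split_var_restrict Z j p : restrict (j |: Z) p = p -> j \notin Z ->
  forall i, restrict Z (split_var j p)`_i = (split_var j p)`_i.
Proof.
move=> pZ jZ i; rewrite -[LHS](coef_map (restrict Z)).
suff -> : map_poly (restrict Z) (split_var j p) = split_var j p by [].
rewrite -[in RHS]pZ.
apply: (mpoly_rmorph_ext (f := map_poly (restrict Z) \o split_var j)
  (g := split_var j \o restrict (j |: Z))) => /= [c|k].
  by rewrite restrictC split_varC map_polyC /= restrictC.
rewrite restrictX split_varX !inE; have [->|kj] := eqVneq k j.
  by rewrite map_polyX split_varX eqxx.
rewrite /= map_polyC /= restrictX; case: ifP => _; rewrite ?rmorph0 //.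
by rewrite split_varX (negPf kj).
Qed.

Variable m : set S.
Hypothesis max_m : maximal_ideal m.

Let sm : submodule setT m. Proof. by case: max_m. Qed.
Let m1 : ~ m 1. Proof. by case: max_m. Qed.

(** The variables in [Z] are algebraically independent over [K] in [S / m]. *)
Definition indep Z := forall p, restrict Z p = p -> m p -> p = 0.

Lemma indep1 k : (forall f : {poly K}, m (in_var k f) -> f = 0) -> indep [set k].
Proof.
move=> km p pk; pose h (j : 'I_n) : {poly K} := if j == k then 'X else 0.
pose to_poly := mmap (@polyC K) h.
have pE : in_var k (to_poly p) = p.
  rewrite -[RHS]pk; apply: (mpoly_rmorph_ext
    (f := horner_eval 'X_k \o map_poly (@mpolyC n K) \o to_poly) (g := restrict [set k])) => [c|j].
    by rewrite /= /to_poly mmapC map_polyC /= /horner_eval hornerC restrictC.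
  rewrite /= /to_poly mmapX mmap1U /horner_eval restrictX inE /h.
  by case: eqP => [->|_]; rewrite ?map_polyX ?hornerX // rmorph0 horner0.
by rewrite -{1}pE => /km p0; rewrite -pE p0 /in_var rmorph0 horner0.
Qed.

(** * A maximal set of variables independent modulo [m] *)

Section MaximalIndependent.
Variables (Z : {set 'I_n}) (B : comNzRingType) (pi : {rmorphism S -> B}).
Hypotheses (indepZ : indep Z) (maxZ : forall j, j \notin Z -> ~ indep (j |: Z)).
Hypothesis piE : forall p, pi p = 0 <-> m p.

(** Integrality over [phi] means integrality over the image of [K[Z]]. *)
Let phi : {rmorphism S -> B} := pi \o restrict Z.
Local Notation int := (integralOver phi).

Let int_restrict p : restrict Z p = p -> int (pi p).
Proof. by move=> pZ; rewrite -pZ; apply: (integral_id phi). Qed.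

(** By maximality of [Z], some nonzero [p] in [m] is a polynomial in ['X_j] over [K[Z]]. If it has
    degree [r] and leading coefficient [c], then [c ^+ r.-1 * p] is a monic equation of degree [r]
    for [c * 'X_j]. *)
Lemma exists_denominator j : j \notin Z ->
  exists c, [/\ c != 0, restrict Z c = c & int (pi (c * 'X_j))].
Proof.
move=> jZ; have /existsNP[p /not_implyP[pZ /not_implyP[mp /eqP p0]]] := maxZ jZ.
pose q := split_var j p; have qX : q.['X_j] = p := split_varK j p.
have qZ i : restrict Z q`_i = q`_i by apply: split_var_restrict.
have q0 : q != 0 by apply: contraNneq p0 => q0; rewrite -qX q0 horner0.
exists (lead_coef q); split; rewrite ?lead_coef_eq0 ?lead_coefE //.
set r := (size q).-1; have size_q : size q = r.+1 by rewrite prednK // size_poly_gt0.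
(* In degree zero [p] would be a nonzero element of [K[Z]] in [m]. *)
have r0 : (0 < r)%N.
  rewrite lt0n; apply: contra_neqN p0 => /eqP r0.
  have /size_poly1P[c _ qc] : size q == 1%N by rewrite size_q r0.
  apply: indepZ => //; move: (qZ 0%N); rewrite qc coefC eqxx => cZ.
  by rewrite -qX qc hornerC.
set c := q`_r.
have cZ : restrict Z c = c by apply: qZ.
pose F := \poly_(i < r) pi (q`_i * c ^+ (r.-1 - i)).
apply: (integral_root_monic (p := 'X^r + F)).
- by rewrite monicE lead_coefDl ?lead_coefXn // size_polyXn ltnS size_poly.
- rewrite /root hornerD hornerXn horner_poly; apply/eqP.
  have -> : pi (c * 'X_j) ^+ r + \sum_(i < r) pi (q`_i * c ^+ (r.-1 - i)) * pi (c * 'X_j) ^+ i =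
      pi (c ^+ r.-1 * q.['X_j]).
    rewrite horner_coef size_q big_ord_recr /= mulrDr rmorphD addrC; congr (_ + _).
      rewrite mulr_sumr rmorph_sum; apply: eq_bigr => i _.
      rewrite -rmorphXn -rmorphM exprMn; congr (pi _).
      have ir : (i <= r.-1)%N by rewrite -ltnS prednK.
      by rewrite -[in RHS](subnK ir) exprD (mulrC q`_i) mulrACA.
    by rewrite -rmorphXn exprMn mulrA -exprSr prednK.
  by apply/piE; rewrite qX; case: sm => _ _; apply.
- apply/integral_poly => i; rewrite coefD coefXn coef_poly.
  apply: integral_add; first exact: integral_nat.
  case: ifP => _; last exact: integral0.
  by apply: int_restrict; rewrite rmorphM rmorphXn /= qZ cZ.
Qed.

(** For [C] the product of the denominators, the [p] made integral by a power of [C] are closed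
    under sums and products, and include the constants and the variables. *)
Lemma exists_common_denominator : exists c, [/\ c != 0, restrict Z c = c &
  forall p, exists M, int (pi (c ^+ M * p))].
Proof.
have /choice[c cP] j : exists c, j \notin Z ->
    [/\ c != 0, restrict Z c = c & int (pi (c * 'X_j))].
  by have [jZ|/exists_denominator[c cP]] := boolP (j \in Z); [exists 0|exists c].
pose C := \prod_(j | j \notin Z) c j.
have CZ : restrict Z C = C by rewrite rmorph_prod; apply: eq_bigr => j /cP[].
exists C; split=> //; first by apply/prodf_neq0 => j /cP[].
have intC a : int (pi (C ^+ a)) by apply: int_restrict; rewrite rmorphXn /= CZ.
pose T p := exists M, int (pi (C ^+ M * p)).
have TD p q : T p -> T q -> T (p + q).
  move=> [M Mp] [N Nq]; exists (M + N)%N.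
  rewrite (_ : _ * _ = C ^+ N * (C ^+ M * p) + C ^+ M * (C ^+ N * q)); last first.
    by rewrite exprD mulrDr !mulrA (mulrC (C ^+ N)).
  rewrite rmorphD (rmorphM pi (C ^+ N) (_ * p)) (rmorphM pi (C ^+ M) (_ * q)).
  by apply: integral_add; apply: integral_mul.
have TM p q : T p -> T q -> T (p * q).
  move=> [M Mp] [N Nq]; exists (M + N)%N.
  rewrite (_ : _ * _ = (C ^+ M * p) * (C ^+ N * q)); last by rewrite exprD mulrACA.
  by rewrite rmorphM; apply: integral_mul.
have TC b : T b%:MP by exists 0%N; rewrite mul1r; apply: int_restrict; rewrite restrictC.
have TX j : T 'X_j.
  exists 1%N; rewrite expr1; have [jZ|jZ] := boolP (j \in Z).
    by apply: int_restrict; rewrite rmorphM /= CZ restrictX jZ.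
  have [_ _ intj] := cP j jZ.
  rewrite /C (bigD1 j) //= mulrAC rmorphM.
  apply: integral_mul => //; apply: int_restrict; rewrite rmorph_prod.
  by apply: eq_bigr => i /andP[/cP[]].
move=> p; rewrite (mpolyE p) -/(T _); elim/big_ind: _ => [||a _]; first exact: (TC 0).
- exact: TD.
rewrite -mul_mpolyC; apply: (TM) (TC _) _; rewrite mpolyXE_id.
elim/big_ind: _ => [||j _]; first exact: (TC 1).
- exact: TM.
by elim: (a j) => [|b IHb]; [exact: (TC 1)|rewrite exprS; apply: (TM)].
Qed.

(* If [k \in Z], the inverse of [1 + x_k c] modulo [m] is integral over
   [K[Z][1/c]], so [1 + x_k c] divides a power of [c] in [K[Z]]. *)
Lemma maximal_indep_empty k : k \notin Z.
Proof.
apply/negP => kZ; have [c [c0 cZ denom]] := exists_common_denominator.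
pose P : S := 1 + 'X_k * c.
have PZ : restrict Z P = P by rewrite rmorphD rmorph1 rmorphM /= restrictX kZ cZ.
have Xc0 : ('X_k * c)@_0%MM = 0.
  by rewrite (rmorphM (mcoeff 0%MM)) /= mcoeffX mnm1_eq0 mul0r.
have P0 : P != 0.
  apply/eqP => /(congr1 (mcoeff 0%MM))/eqP; rewrite mcoeffD mcoeff1 eqxx Xc0 mcoeff0.
  by rewrite addr0 oner_eq0.
have mP : ~ m P by move=> mP; case/eqP: P0; apply: indepZ.
have [q mPq] := maximal_ideal_inv max_m mP.
have piPq : pi P * pi q = 1.
  by apply/eqP; rewrite -subr_eq0 -rmorphM -(rmorph1 pi) -rmorphB; apply/eqP/piE.
have [M [F monF /rootP rootF]] := denom q.
set N := (size F).-1; have size_F : size F = N.+1.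
  by rewrite prednK // size_poly_gt0 monic_neq0.
(* The monic equation of [c ^+ M * q] is multiplied by [P ^+ N] to eliminate [q], the inverse of [P]
   modulo [m]. The result lies in [K[Z]] and in [m], so it vanishes. *)
pose G i := restrict Z F`_i * (c ^+ M) ^+ i * P ^+ (N - i).
have G0 : \sum_(i < N.+1) G i = 0.
  apply: indepZ.
    rewrite rmorph_sum; apply: eq_bigr => i _.
    by rewrite !rmorphM !rmorphXn /= restrict_id PZ cZ.
  apply/piE; rewrite rmorph_sum.
  transitivity (pi P ^+ N * (map_poly phi F).[pi (c ^+ M * q)]); last by rewrite rootF mulr0.
  rewrite (horner_coef_wide _ (n := N.+1)); last by rewrite -size_F size_poly.
  rewrite mulr_sumr; apply: eq_bigr => i _; rewrite coef_map /G /= !rmorphM !rmorphXn /=.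
  have iN : (i <= N)%N by rewrite -ltnS.
  move: (nat_of_ord i) iN => {}i iN; rewrite exprMn -[in RHS](subnK iN) exprD.
  have E : pi P ^+ i * pi q ^+ i = 1 by rewrite -exprMn piPq expr1n.
  transitivity (pi (restrict Z F`_i) * (pi c ^+ M) ^+ i * pi P ^+ (N - i) *
    (pi P ^+ i * pi q ^+ i)); first by rewrite E mulr1.
  by ring.
(* The leading term of that relation is [c ^+ (M * N)]; all others are divisible by [P]. *)
have [Y cY] : exists Y, c ^+ (M * N) = P * Y.
  exists (- \sum_(i < N) restrict Z F`_i * (c ^+ M) ^+ i * P ^+ (N - i).-1).
  move: G0; rewrite big_ord_recr /= /G subnn expr0 mulr1.
  have -> : F`_N = 1 by apply/monicP.
  rewrite rmorph1 mul1r -exprM => /eqP; rewrite addrC addr_eq0 => /eqP ->.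
  rewrite mulrN mulr_sumr; congr (- _); apply: eq_bigr => i _.
  have iN : (0 < N - i)%N by rewrite subn_gt0.
  by rewrite -[in LHS](prednK iN) exprS mulrCA.
have [w Pw] := exp_sub1 P (M * N).
(* The power of [P - 1 = 'X_k * c] of exponent [M * N] is divisible by [P] and congruent to a sign
   modulo [P]. So [P] is a unit, hence constant, which forces ['X_k * c = 0]. *)
have unitP : (P * ((-1) ^+ (M * N) * ('X_k ^+ (M * N) * Y - w))) = 1.
  have PX : P - 1 = 'X_k * c by rewrite /P addrC addKr.
  have : (P - 1) ^+ (M * N) = P * ('X_k ^+ (M * N) * Y).
    by rewrite PX exprMn cY mulrCA.
  rewrite Pw => /(canRL (addrK _)) sgn.
  rewrite mulrCA mulrBr -sgn -exprD addnn -mul2n exprM sqrrN expr1n expr1n //.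
have /andP[/eqP Pc _] : P \in @mpoly_unit n K by apply: (mpoly_intro_unit (q := _)); rewrite mulrC; exact: unitP.
case/eqP: c0; have : 'X_k * c = 0.
  move: Pc; rewrite mcoeffD mcoeff1 eqxx Xc0 addr0 => /eqP.
  by rewrite /P -subr_eq0 addrC addKr => /eqP.
move/eqP; rewrite mulf_eq0 => /orP[|/eqP//].
by move/eqP/(congr1 (mcoeff U_(k)%MM))/eqP; rewrite mcoeffX eqxx mcoeff0 oner_eq0.
Qed.

End MaximalIndependent.

(** Otherwise [[set k]] would be independent and extend to a maximal independent set, which has to
    be empty. *)
Lemma maximal_ideal_in_var k : exists2 f : {poly K}, f != 0 & m (in_var k f).
Proof.
apply: contrapT => noF.
have indepk : indep [set k].
  by apply: indep1 => f mf; apply: contrapT => /eqP f0; apply: noF; exists f.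
have [Z /maxsetP[/asboolP indepZ maxZ] kZ] :=
  maxset_exists (P := fun Z => `[< indep Z >]) (introT (asboolP _) indepk).
have [B [pi piE]] := exists_quotient sm m1.
have : k \notin Z; last by move: kZ; rewrite finset.sub1set => ->.
apply: (maximal_indep_empty indepZ _ piE) => j jZ indepj.
have := maxZ (j |: Z); rewrite finset.subsetUr => /(_ (introT (asboolP _) indepj) isT) Zj.
by move: jZ; rewrite -Zj setU11.
Qed.

End Nullstellensatz.

(** * Localization *)

Lemma maximal_ideal_prime (R : comNzRingType) (m : set R) :
  maximal_ideal m -> prime_ideal setT m.
Proof.
move=> max_m; have [sm m1 _] := max_m; split=> // x y _ _ mxy.
have [mx|mx] := pselect (m x); [by left|right].
have [z mz] := maximal_ideal_inv max_m mx.
have -> : y = z * (x * y) - y * (x * z - 1) by ring.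
by apply: (submoduleB (subring_setT R)) => //; case: sm => _ _; apply.
Qed.

Section Localization.
Variables (R : idomainType) (m : set R).
Hypothesis prime_m : prime_ideal setT m.
Implicit Types (L J : set R) (a s t x : R) (xs : seq R).

Local Notation loc := (localize m).
Local Notation A := (localize m setT).

Let m0 : m 0. Proof. by case: prime_m => _ []. Qed.
Let m1 : ~ m 1. Proof. by case: prime_m. Qed.
Let mM s t : ~ m s -> ~ m t -> ~ m (s * t).
Proof. by move=> ms mt; case: prime_m => _ _ _ mP /(mP _ _ I I)[]. Qed.

Lemma notin_prime_tofrac_neq0 s : ~ m s -> tofrac s != 0.
Proof. by move=> ms; rewrite tofrac_eq0; apply/eqP => s0; apply: ms; rewrite s0. Qed.

Lemma localize_tofrac L a : L a -> loc L (tofrac a).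
Proof. by move=> La; exists a, 1; rewrite tofrac1 divr1. Qed.

Lemma localizeP L a : submodule setT L ->
  loc L (tofrac a) <-> exists2 s, ~ m s & L (s * a).
Proof.
move=> sL; split=> [[b [s [Lb ms /(canLR (mulfVK (notin_prime_tofrac_neq0 ms)))]]]|[s ms Lsa]].
  by rewrite -tofracM => /eqP; rewrite tofrac_eq => /eqP ab; exists s; rewrite // mulrC ab.
exists (s * a), s; split=> //.
by rewrite tofracM mulrAC divff ?mul1r ?notin_prime_tofrac_neq0.
Qed.

Lemma localize_mono L J : L `<=` J -> loc L `<=` loc J.
Proof. by move=> LJ _ [a [s [La ms ->]]]; exists a, s; split=> //; apply: LJ. Qed.

Lemma localize_subring : subring A.
Proof.
split; first by rewrite -tofrac1; apply: localize_tofrac.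
- move=> _ _ [a [s [_ ms ->]]] [b [t [_ mt ->]]].
  exists (a * t - b * s), (s * t); split; [by []|exact: mM|].
  by rewrite tofracB !tofracM -mulNr addf_div ?notin_prime_tofrac_neq0 // mulNr.
- move=> _ _ [a [s [_ ms ->]]] [b [t [_ mt ->]]].
  by exists (a * b), (s * t); split; [|exact: mM|rewrite !tofracM invfM mulrACA].
Qed.

Lemma localize_submodule L : submodule setT L -> submodule A (loc L).
Proof.
move=> [L0 LD LM]; split; first by rewrite -tofrac0; apply: localize_tofrac.
- move=> _ _ [a [s [La ms ->]]] [b [t [Lb mt ->]]].
  exists (t * a + s * b), (s * t); split; [by apply: LD; apply: LM|exact: mM|].
  rewrite tofracD !tofracM addf_div ?notin_prime_tofrac_neq0 //.
  by congr (_ / _); congr (_ + _); apply: mulrC.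
- move=> _ _ [a [s [_ ms ->]]] [b [t [Lb mt ->]]].
  by exists (a * b), (s * t); split; [exact: LM|exact: mM|rewrite !tofracM invfM mulrACA].
Qed.

Lemma localize_add_mul L J x : submodule setT L -> submodule setT J ->
  loc (add_mul L J x) = add_mul (loc L) (loc J) (tofrac x).
Proof.
move=> [_ _ LM] [_ _ JM]; apply/seteqP; split.
  move=> _ [_ [s [[j [l [Jj Ll ->]]] ms ->]]].
  exists (tofrac j / tofrac s), (tofrac l / tofrac s); split; [by exists j, s|by exists l, s|].
  by rewrite tofracD tofracM mulrDl mulrA.
move=> _ [_ [_ [[j [s [Jj ms ->]]] [l [t [Ll mt ->]]] ->]]].
exists (t * j + x * (s * l)), (s * t); split; [|exact: mM|].
  by exists (t * j), (s * l); split=> //; [exact: JM|exact: LM].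
rewrite tofracD !tofracM [tofrac x * (_ / _)]mulrA addf_div ?notin_prime_tofrac_neq0 //.
by rewrite -[tofrac x * _ * _]mulrA (mulrC (tofrac l)) (mulrC (tofrac j)).
Qed.

Lemma localize_add_muls L J xs : submodule setT L -> submodule setT J ->
  loc (add_muls L J xs) = add_muls (loc L) (loc J) (map (@tofrac R) xs).
Proof.
move=> sL; elim: xs J => //= x xs IHxs J sJ.
by rewrite IHxs ?localize_add_mul //; apply: add_mul_submodule.
Qed.

Lemma localize_weakly_regular L J xs : submodule setT L -> submodule setT J ->
  weakly_regular L J xs -> weakly_regular (loc L) (loc J) (map (@tofrac R) xs).
Proof.
move=> sL; elim: xs J => //= x xs IHxs J sJ [nzd reg]; split; last first.
  by rewrite -localize_add_mul //; apply: IHxs => //; apply: add_mul_submodule.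
have [_ _ LM] := sL; have [_ _ locM] := localize_submodule sJ.
move=> _ [l [s [Ll ms ->]]] Jxl.
have /localizeP[//|t mt Jtxl] : loc J (tofrac (x * l)).
  have -> : tofrac (x * l) = tofrac s * (tofrac x * (tofrac l / tofrac s)).
    by rewrite tofracM mulrCA (mulrC (tofrac s)) divfK ?notin_prime_tofrac_neq0.
  by apply: locM Jxl; apply: localize_tofrac.
exists (t * l), (t * s); split; [apply: nzd; [exact: LM|by rewrite mulrCA]|exact: mM|].
by rewrite !tofracM -mulf_div divff ?mul1r ?notin_prime_tofrac_neq0.
Qed.

(** A prime of the localization is determined by the numerators of its elements, so contraction
    keeps inclusions strict. Bounds on chains over [R] thus hold over the localization. *)
Lemma prime_chain_contract L J e (Q : nat -> set {fraction R}) :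
    prime_chain A (loc L) (loc J) e Q ->
  prime_chain setT L J e (fun i => [set a | Q i (tofrac a)]).
Proof.
have Afrac a : A (tofrac a) by apply: localize_tofrac.
move=> [primeQ ltQ]; split=> i ltie.
  have [[QA [Q0 QD QM] Q1 Qprime] annQ] := primeQ i ltie; split.
    split=> //.
    - split=> [|x y Qx Qy|a x _ Qx] /=; first by rewrite rmorph0.
      + by rewrite tofracD; apply: QD.
      + by rewrite tofracM; apply: QM.
    - by move=> x y _ _ /=; rewrite tofracM; apply: Qprime.
  move=> a [_ aL]; apply: annQ; split=> // _ [l [s [Ll ms ->]]].
  by exists (a * l), s; split=> //; [exact: aL|rewrite tofracM mulrA].
have [subQ /existsNP[x /not_implyP[Qx nQx]]] := ltQ i ltie; split=> [a /subQ//|Qsub].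
have [[QA' [_ _ QM'] _ _] _] := primeQ i.+1 ltie.
have [[_ [_ _ QM] _ _] _] := primeQ i (ltnW ltie).
have [a [s [_ ms x_eq]]] := QA' _ Qx; apply: nQx.
rewrite x_eq mulrC; apply: QM.
  by exists 1, s; rewrite tofrac1 mul1r.
apply: Qsub => /=; have -> : tofrac a = tofrac s * x.
  by rewrite x_eq mulrCA divff ?mulr1 ?notin_prime_tofrac_neq0.
exact: QM'.
Qed.

(** A regular sequence yields a prime chain of the same length, so the one bound on chains limits
    dimension and depth alike; the sequence [xs] attains both. *)
Lemma local_cohen_macaulayI L J d xs : submodule setT L -> submodule setT J ->
    (forall e Q, prime_chain setT L J e Q -> (e <= d)%N) ->
    size xs = d -> (forall x, x \in xs -> m x) ->
    regular_seq (loc L) (loc J) (map (@tofrac R) xs) ->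
  local_cohen_macaulay A (loc m) (loc L) (loc J).
Proof.
move=> sL sJ bound size_xs mxs reg.
have mA : loc m `<=` A by apply: localize_mono.
have chain ys : (forall y, y \in ys -> loc m y) -> regular_seq (loc L) (loc J) ys ->
    exists Q, prime_chain A (loc L) (loc J) (size ys) Q.
  move=> mys; apply: regular_seq_prime_chain; try exact: localize_submodule.
  - exact: localize_subring.
  - by move=> y /mys/mA.
have mfxs y : y \in map (@tofrac R) xs -> loc m y.
  by case/mapP => x /mxs mx ->; apply: localize_tofrac.
exists d; split; split.
- by have := chain _ mfxs reg; rewrite size_map size_xs.
- by move=> e Q /prime_chain_contract/bound.
- by exists (map (@tofrac R) xs); split; rewrite ?size_map.
- by move=> ys mys /(chain ys mys)[Q /prime_chain_contract/bound].
Qed.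

End Localization.

(** * Cohen-Macaulay filtrations *)

Section PrimeFiltrations.
Variables (K : fieldType) (n : nat).
Local Notation S := {mpoly K[n]}.
Implicit Types (J L N m : set S) (p q : S) (t w : 'X_{1..n}) (Z : {set 'I_n}) (d : nat).

Definition var_ideal Z : set S := mideal [set w | outside Z w].

(** Multiplication by ['X_[t]] from [S] to [S / N] has kernel [var_ideal Z], so each layer is a copy
    of [S / var_ideal Z]. *)
Inductive prime_filt d J : set S -> Prop :=
| prime_filt0 : prime_filt d J J
| prime_filtS N t Z : prime_filt d J N -> #|Z| = d ->
    (forall p, N ('X_[t] * p) <-> var_ideal Z p) ->
    prime_filt d J (add_mul setT N 'X_[t]).

Lemma mfilt_prime_filt d U W : upclosed U -> mfilt d U W ->
  upclosed W /\ prime_filt d (mideal U) (mideal W).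
Proof.
move=> upU; elim=> [|{}W t Z _ [upW IH] cardZ tZ]; first by split=> //; left.
split.
  move=> m w [Wm|tm]; [left; exact: upW|right].
  by apply: lepm_trans tm (lem_addr _ _).
rewrite mideal_add //; apply: prime_filtS IH cardZ _ => p; rewrite midealMX.
by rewrite (_ : [set w | _] = [set w | outside Z w]) //; apply/seteqP; split=> w /tZ.
Qed.

Lemma prime_filt_submodule d J L : submodule setT J -> prime_filt d J L ->
  submodule setT L /\ J `<=` L.
Proof.
have sT := subring_submodule (subring_setT S).
move=> sJ; elim=> [|{}L t Z _ [sL JL] _ _]; first by split.
split; first exact: add_mul_submodule.
by apply: subset_trans JL _; apply: sub_add_mul sT.
Qed.

(** If [Q] contained no [var_ideal] of a layer, an element outside [Q] could be taken from each;
    their product kills [L / J] and is not in the prime [Q]. *)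
Lemma prime_filt_annihilator d J L (Q : set S) : submodule setT J ->
    prime_filt d J L -> prime_ideal setT Q -> annihilator setT L J `<=` Q ->
  exists2 Z : {set 'I_n}, #|Z| = d & var_ideal Z `<=` Q.
Proof.
move=> sJ JL primeQ annQ; apply: contrapT => noZ.
have [a Qa aL] : exists2 a, ~ Q a & forall l, L l -> J (a * l); last first.
  by apply: Qa; apply: annQ.
have [J0 JD JM] := sJ; have [_ _ Q1 QP] := primeQ.
elim: JL => [|{annQ}N t Z JN [a Qa aN] cardZ tZ].
  by exists 1 => // l; rewrite mul1r.
have [b bZ Qb] : exists2 b, var_ideal Z b & ~ Q b.
  by apply: contrapT => nob; apply: noZ; exists Z => // b bZ; apply: contrapT => Qb;
    apply: nob; exists b.
exists (a * b) => [/QP[]//|_ [u [v [Nu _ ->]]]].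
have [[_ _ NM] _] := prime_filt_submodule sJ JN.
rewrite mulrDr; apply: (JD); first by rewrite mulrAC mulrC; apply: JM => //; apply: aN.
have -> : a * b * ('X_[t] * v) = v * (a * ('X_[t] * b)).
  by rewrite mulrC -mulrA mulrCA; congr (_ * _); rewrite mulrC -mulrA (mulrC b).
by apply: JM => //; apply: aN; apply/tZ.
Qed.

Lemma prime_filt_chain_bound d J L e (Q : nat -> set S) : submodule setT J ->
  prime_filt d J L -> prime_chain setT L J e Q -> (e <= d)%N.
Proof.
move=> sJ JL [primeQ ltQ]; have [prime0 ann0] := primeQ 0%N isT.
have [Z <- ZQ] := prime_filt_annihilator sJ JL prime0 ann0.
by apply: prime_chain_bound ltQ ZQ => i /primeQ[].
Qed.

(** * Prime filtrations localized at a maximal ideal *)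

Section AtMaximalIdeal.
Variable m : set S.
Hypothesis max_m : maximal_ideal m.

Let prime_m : prime_ideal setT m := maximal_ideal_prime max_m.
Let sm : submodule setT m. Proof. by case: max_m. Qed.
Let sT : submodule setT setT := subring_submodule (subring_setT S).
Local Notation loc := (localize m).
Local Notation tofracs := (map (@tofrac S)).

(** The last clause makes [var_ideal Z] equal to the [compl_ideal] of the chosen elements whenever
    it is contained in [m]. *)
Lemma exists_parameters : exists f : 'I_n -> {poly K},
  forall k, [/\ f k != 0, m (in_var k (f k)) & m 'X_k -> in_var k (f k) = 'X_k].
Proof.
suff /choice[f fP] : forall k, exists f : {poly K},
    [/\ f != 0, m (in_var k f) & m 'X_k -> in_var k f = 'X_k] by exists f.
move=> k.
have [mX|mX] := pselect (m 'X_k).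
  have XE : in_var k ('X : {poly K}) = 'X_k by rewrite /in_var map_polyX hornerX.
  by exists 'X; rewrite polyX_eq0 XE.
by have [f f0 mf] := maximal_ideal_in_var max_m k; exists f.
Qed.

Variable f : 'I_n -> {poly K}.
Hypothesis fP : forall k, [/\ f k != 0, m (in_var k (f k)) & m 'X_k -> in_var k (f k) = 'X_k].

Local Notation y := (fun k => in_var k (f k)).
Definition parameters d := [seq esym y j | j <- rev (iota 1 d)].

Lemma parameters_in d x : x \in parameters d -> m x.
Proof.
case/mapP => j; rewrite mem_rev mem_iota => /andP[j0 _] ->.
apply: (submodule_sum sm) => T /eqP cardT.
have /card_gt0P[k kT] : (0 < #|T|)%N by rewrite cardT.
rewrite (bigD1 k) //= mulrC; case: sm => _ _; apply=> //.
by have [] := fP k.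
Qed.

Lemma parameters_regular_var_ideal Z : var_ideal Z `<=` m ->
  weakly_regular setT (var_ideal Z) (parameters #|Z|).
Proof.
move=> Zm; have yX k : k \notin Z -> y k = 'X_k.
  move=> kZ; have [_ _ ->//] := fP k; apply: Zm; apply/midealX.
  by apply/outsideP; exists k; rewrite // mnm1E eqxx.
suff -> : var_ideal Z = compl_ideal y Z.
  apply: esym_weakly_regular => W k kW.
  by apply: (in_var_nzd (f := f)) => //; case: (fP k).
have upZ : upclosed [set w | outside Z w].
  by move=> w w'; rewrite /= outsideD => ->.
apply/seteqP; split.
  apply: mideal_min (compl_ideal_submodule _ _) _ => w /outsideP[k kZ].
  rewrite lt0n -lep1mP => /lem_addE[r ->]; rewrite mpolyXD mulrC.
  have [_ _ JM] := compl_ideal_submodule y Z.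
  by apply: JM => //; rewrite -yX //; apply: (compl_ideal_gen y).
move=> _ [a ->]; have sZ := mideal_submodule K upZ.
apply: (submodule_sum sZ) => k kZ; have [_ _ ZM] := sZ.
rewrite yX //; apply: ZM => //; apply/midealX.
by apply/outsideP; exists k; rewrite // mnm1E eqxx.
Qed.

Lemma prime_filt_regular d J L : submodule setT J -> prime_filt d J L ->
  weakly_regular (loc L) (loc J) (tofracs (parameters d)) /\
  (loc L `<=` loc J \/ ~ (loc L `<=` add_muls (loc L) (loc J) (tofracs (parameters d)))).
Proof.
move=> sJ; elim=> [|N t Z JN [regN nzN] cardZ tZ].
  split; last by left.
  exact: weakly_regular_zero (localize_submodule prime_m sJ) _.
have [sN JsubN] := prime_filt_submodule sJ JN.
set L' := add_mul setT N 'X_[t].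
have sL' : submodule setT L' by apply: add_mul_submodule.
have NL' : N `<=` L' := @sub_add_mul _ setT setT N _ sT.
(* If [var_ideal Z] is not inside [m], an element of it outside [m] kills the new layer, which
   disappears under localization. *)
have [Zm|/existsNP[p /not_implyP[Zp mp]]] := pselect (var_ideal Z `<=` m); last first.
  suff -> : loc L' = loc N by [].
  apply/seteqP; split; last exact: localize_mono.
  move=> _ [l [s [[u [v [Nu _ ->]]] ms ->]]]; exists (p * (u + 'X_[t] * v)), (p * s).
  have [_ ND NM] := sN; split.
  - rewrite mulrDr; apply: ND; first exact: NM.
    have -> : p * ('X_[t] * v) = v * ('X_[t] * p) by rewrite mulrC -mulrA mulrCA mulrC.
    by apply: NM => //; apply/tZ.
  - by case: prime_m => _ _ _ mP /(mP _ _ I I)[].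
  - by rewrite !tofracM -mulf_div divff ?mul1r ?(notin_prime_tofrac_neq0 prime_m).
have regL' : weakly_regular L' N (parameters d).
  apply: (@weakly_regular_ext _ setT L' N setT (var_ideal Z) 'X_[t]) => //.
  - by move=> p _; exists 0, p; split; rewrite ?add0r //; case: sN.
  - by move=> p /tZ.
  - by move=> p _ /tZ.
  - by rewrite -cardZ; apply: parameters_regular_var_ideal.
  - exact: weakly_regular_zero sL' _.
have locM L1 := @localize_submodule _ m prime_m L1.
split.
  (* With [c = 1] this is the extension of [L' / N] by [N / J]. *)
  apply: (@weakly_regular_ext _ (loc setT) (loc L') (loc J) (loc N) (loc J) 1).
  - exact: (localize_subring prime_m).
  - by move=> _ /mapP[x _ ->]; apply: (localize_tofrac prime_m).
  - exact: locM.
  - exact: locM.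
  - exact: locM.
  - by apply: localize_mono; apply: subset_trans NL'.
  - by move=> x; rewrite mul1r; apply: localize_mono.
  - by move=> x; rewrite mul1r.
  - by move=> x _; rewrite mul1r.
  - exact: regN.
  - rewrite (_ : add_mul (loc N) (loc J) 1 = loc N).
      exact: localize_weakly_regular.
    have [N0 ND _] := locM _ sN; have [J0 _ _] := locM _ sJ.
    apply/seteqP; split=> [_ [u [v [Ju Nv ->]]]|x Nx].
      by rewrite mul1r; apply: ND => //; apply: localize_mono Ju.
    by exists 0, x; split; rewrite // mul1r add0r.
right=> locL'.
(* If the parameters generated everything, ['X_[t]] would lie in the localization of [H], the sum of
   [N] and ['X_[t]] times [m]. So ['X_[t] * (s - v)] is in [N] with [s] outside [m] and [v] in [m],
   and [s - v] is in [var_ideal Z], hence in [m]: a contradiction. *)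
pose H := [set x | exists u s, [/\ N u, m s & x = u + 'X_[t] * s]].
have [N0 ND NM] := sN; have [m0 mD mM] := sm.
have LH : loc L' `<=` loc H.
  apply: subset_trans locL' _; apply: subset_trans (add_muls_mono (localize_mono JsubN)) _.
  rewrite -localize_add_muls //; apply: localize_mono; apply: add_muls_sub.
  - move=> _ _ [u [s [Nu ms ->]]] [u' [s' [Nu' ms' ->]]].
    by exists (u + u'), (s + s'); split; [exact: ND|exact: mD|rewrite mulrDr addrACA].
  - by move=> u Nu; exists u, 0; split; rewrite ?mulr0 ?addr0.
  - move=> x _ /parameters_in mx [u [v [Nu _ ->]]].
    exists (x * u), (v * x); split; [exact: NM|exact: mM|].
    by rewrite mulrDr; congr (_ + _); rewrite mulrC -mulrA.
have sH : submodule setT H.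
  split=> [|_ _ [u [s [Nu ms ->]]] [u' [s' [Nu' ms' ->]]]|a _ _ [u [s [Nu ms ->]]]].
  - by exists 0, 0; split; rewrite // mulr0 addr0.
  - by exists (u + u'), (s + s'); split; [exact: ND|exact: mD|rewrite mulrDr addrACA].
  - by exists (a * u), (a * s); split; [exact: NM|exact: mM|rewrite mulrDr mulrCA].
have /LH/(localizeP prime_m _ sH)[s ms [u [v [Nu mv sX]]]] :
    loc L' (tofrac ('X_[t] : S)).
  by apply: (localize_tofrac prime_m); exists 0, 1; split; rewrite // add0r mulr1.
apply: ms; rewrite -(subrK v s); apply: (mD) => //; apply: Zm; apply/tZ.
by rewrite mulrBr mulrC sX addrK.
Qed.

End AtMaximalIdeal.

Lemma prime_filt_regular_seq d J L m : submodule setT J -> prime_filt d J L ->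
    maximal_ideal m -> ~ (localize m L `<=` localize m J) ->
  exists xs, [/\ size xs = d, (forall x, x \in xs -> m x) &
    regular_seq (localize m L) (localize m J) (map (@tofrac S) xs)].
Proof.
move=> sJ JL max_m LJ; have [f fP] := exists_parameters max_m.
exists (parameters f d); split.
- by rewrite size_map size_rev size_iota.
- by move=> x; apply: (parameters_in max_m fP).
- by apply/regular_seqE; have [reg []] := prime_filt_regular max_m fP sJ JL.
Qed.

Lemma prime_filt_cohen_macaulay d J L : submodule setT J -> prime_filt d J L ->
  cohen_macaulay L J.
Proof.
move=> sJ JL m max_m LJ.
have [xs [size_xs mxs reg]] := prime_filt_regular_seq sJ JL max_m LJ.
apply: (local_cohen_macaulayI (maximal_ideal_prime max_m) _ sJ _ size_xs mxs reg).
  by case: (prime_filt_submodule sJ JL).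
by move=> e Q; apply: prime_filt_chain_bound.
Qed.

Definition origin : set S := [set p | p@_0%MM = 0].

Lemma origin_maximal : maximal_ideal origin.
Proof.
have sO : submodule setT origin.
  split=> [|p q|a p _]; rewrite /origin /= ?mcoeff0 //.
    by move=> p0 q0; rewrite mcoeffD p0 q0 addr0.
  by move=> p0; rewrite (rmorphM (mcoeff 0%MM)) /= p0 mulr0.
split=> //; first by rewrite /origin /= mcoeff1 eqxx; apply/eqP/oner_neq0.
move=> N [N0 ND NM] ON N1 p Np; apply: contrapT => /eqP p0; apply: N1.
have -> : 1 = (p@_0%MM)^-1%:MP * (p - (p - (p@_0%MM)%:MP)) :> S.
  by rewrite subKr -mpolyCM mulVf ?mpolyC1.
apply: (NM) => //; apply: ND => //; rewrite -mulN1r; apply: NM => //; apply: ON.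
by rewrite /origin /= mcoeffB mcoeffC eqxx mulr1 subrr.
Qed.

(** Every [var_ideal Z] lies in [origin], so no layer disappears there. *)
Lemma prime_filt_localize_origin d J L : submodule setT J -> prime_filt d J L ->
  localize origin L `<=` localize origin J -> L `<=` J.
Proof.
have prime_o := maximal_ideal_prime origin_maximal.
move=> sJ [_ x //|N t Z JN cardZ tZ locL].
have [sN JsubN] := prime_filt_submodule sJ JN.
have : localize origin N (tofrac ('X_[t] : S)).
  apply: (localize_mono JsubN); apply: locL; apply: (localize_tofrac prime_o).
  by exists 0, 1; split; rewrite ?add0r ?mulr1 //; case: sN.
case/(localizeP prime_o _ sN) => s os; rewrite mulrC => /tZ Zs.
exfalso; apply: os; rewrite /origin /=; apply: memN_msupp_eq0.
by apply/negP => /Zs /=; rewrite outside0.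
Qed.

(** The regular sequence at the origin gives a chain of length [d] in the localization, and its
    contraction attains the bound. *)
Lemma prime_filt_krull_dim d J L : submodule setT J -> prime_filt d J L ->
  ~ (L `<=` J) -> krull_dim setT L J d.
Proof.
move=> sJ JL LJ; have [sL _] := prime_filt_submodule sJ JL.
have prime_o := maximal_ideal_prime origin_maximal.
split; last by move=> e Q; apply: prime_filt_chain_bound.
have [|xs [size_xs oxs reg]] := prime_filt_regular_seq sJ JL origin_maximal.
  by move=> /(prime_filt_localize_origin sJ JL).
have [|Q] := regular_seq_prime_chain (localize_subring prime_o)
  (localize_submodule prime_o sL) (localize_submodule prime_o sJ) _ reg.
  by move=> _ /mapP[x _ ->]; apply: (localize_tofrac prime_o).
rewrite size_map size_xs => /(prime_chain_contract prime_o) QC.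
by exists (fun i => [set a | Q i (tofrac a)]).
Qed.

End PrimeFiltrations.

(** Repetitions are dropped while each remaining step keeps its original index as dimension, so
    dimensions increase. The extra bound [d j < r] lets the induction append a step of dimension
    [r]. *)
Lemma strict_chain (R : idomainType) (D : nat -> set R) r :
    (forall i, (i <= r)%N -> ideal (D i)) ->
    (forall i, (i < r)%N -> D i `<=` D i.+1) ->
    (forall i, (i < r)%N -> ~ (D i.+1 `<=` D i) ->
       cohen_macaulay (D i.+1) (D i) /\ krull_dim setT (D i.+1) (D i) i) ->
  exists (r' : nat) (C : nat -> set R) (d : nat -> nat),
  [/\ C 0%N = D 0%N, C r' = D r, (forall j, (j <= r')%N -> ideal (C j)),
      (forall j, (j < r')%N ->
         [/\ C j `<` C j.+1, cohen_macaulay (C j.+1) (C j)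
           & krull_dim setT (C j.+1) (C j) (d j)])
    & (forall j, (j.+1 < r')%N -> (d j < d j.+1)%N) /\
      (forall j, (j < r')%N -> (d j < r)%N)].
Proof.
elim: r => [|r IHr] idD subD cmD.
  by exists 0%N, D, id; split=> // -[|].
have [i /leqW/idD|i /leqW/subD|i /leqW/cmD|r' [C [d [C0 Cr idC cmC [ltd ltdr]]]]] := IHr;
  rewrite ?ltnS //.
have [Dr|Dr] := pselect (D r.+1 `<=` D r).
  have {Dr} Dr : D r.+1 = D r by apply/seteqP; split=> //; apply: subD.
  by exists r', C, d; rewrite Dr; split=> //; split=> // j /ltdr/leqW.
exists r'.+1, (fun j => if (j <= r')%N then C j else D r.+1),
  (fun j => if (j < r')%N then d j else r).
split=> //.
- by rewrite ltnn.
- by move=> j _; case: ifP => [/idC|_] //; apply: idD.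
- move=> j /=; rewrite ltnS => lej; rewrite lej; have [->|nej] := eqVneq j r'.
    by rewrite ltnn Cr; have [cm dim] := cmD r (ltnSn r) Dr; split=> //; split=> //; apply: subD.
  have ltj : (j < r')%N by rewrite ltn_neqAle nej lej.
  by rewrite ltj; apply: cmC.
split=> j /=; last by case: ifP => [/ltdr/leqW|].
rewrite ltnS => ltj; rewrite ltj; case: ifP => [/ltd//|_]; exact: ltdr.
Qed.

Theorem corollary3p5 (K : fieldType) (n : nat) (I : set {mpoly K[n]}) :
  monomial_ideal I -> forest_type I -> sequentially_cohen_macaulay I.
Proof.
move=> _ [G [I_eq _] leafG].
pose U := upset [set` G]; have upU : upclosed U by apply: upclosed_upset.
have filt d : mfilt d (dim_below U d) (dim_below U d.+1).
  have -> : U = upset (forest_gens (enum_fset G) finset.set0).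
    congr upset; apply/seteqP; split=> a; first by left.
    by case=> // -[k]; rewrite inE.
  apply: forest_mfilt => [s s0 sG|a k _]; last by rewrite inE.
  have [||u [uA leaf_u]] := leafG [fset x in s]%fset.
  - case: s s0 sG => // a s _ _; apply/fset0Pn; exists a.
    by rewrite !inE eqxx.
  - by move=> a; rewrite inE => /sG.
  exists u; first by rewrite inE in uA.
  case: leaf_u => [A1|[v [vA vu leaf_v]]].
    left=> w ws; have : w \in [fset x in s]%fset by rewrite inE.
    by rewrite A1 inE => /eqP.
  right; exists v; split=> //; first by rewrite inE in vA.
  move=> w ws wu; apply: lepm_trans (leaf_v w _ wu) _; first by rewrite inE.
  by apply/mnm_lepP => i; rewrite mnmE geq_minr.
pose D i : set {mpoly K[n]} := mideal (dim_below U i).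
have sD i : submodule setT (D i) by apply: mideal_submodule; apply: upclosed_dim_below.
have D0 : D 0%N = I.
  rewrite I_eq monomial_genE; congr mideal; apply/seteqP; split; last exact: sub_dim_below.
  move=> m Dm; apply: contrapT => Um; suff : (#|finset.set0 : {set 'I_n}| < 0)%N by [].
  (* The empty set is independent modulo [U : m] unless [m] is in [U], and its cardinal is not below
     zero. *)
  apply: Dm => w Umw; apply/outsideP; apply: contrapT => w0; apply: Um.
  rewrite -[m]addm0 -(_ : w = 0%MM) //; apply/mnmP => i; rewrite mnm0E; apply/eqP.
  by rewrite -leqn0 leqNgt; apply/negP => wi; apply: w0; exists i; rewrite ?inE.
have DT : D n.+1 = setT.
  rewrite -(midealT K n); congr mideal; apply/seteqP; split=> // m _ Z _.
  by rewrite ltnS -[X in (_ <= X)%N](card_ord n) max_card.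
have filtD i : prime_filt i (D i) (D i.+1).
  by have [] := @mfilt_prime_filt K n i _ _ (upclosed_dim_below (d := i) upU) (filt i).
have [|||r [C [d [C0 Cr idC cmC [ltd _]]]]] := @strict_chain _ D n.+1.
- by move=> i _; apply: sD.
- by move=> i _; apply: mideal_mono; apply: dim_below_mono.
- move=> i _ nsub; split; first exact: prime_filt_cohen_macaulay (filtD i).
  exact: prime_filt_krull_dim (filtD i) nsub.
by exists r, C, d; split=> //; [rewrite C0|rewrite Cr].
Qed.
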